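(* Consider the system $x(s+1)=(1-a(s))x(s)+a(s)[P(s)x(s)+u(s)]$, $s=0,1,\ldots$, in $\mathbb{R}^n$ (or the multi-agent system (M) of the context, which is of this form), satisfying (A1) with $u=\mathbf{0}_{n\times1}$ and (A2). Then $x(s)$ asymptotically reaches consensus in mean square for any initial state if and only if one of the following conditions holds: i) $\widetilde{\rho}_{\max}(P)<1$; ii) the sum of each row of $P$ equals $1$, and $P$ has $n-1$ eigenvalues (counted with algebraic multiplicity) whose real parts are all less than $1$.
   Context: Here $P(s)\in\mathbb{R}^{n\times n}$ and $u(s)\in\mathbb{R}^n$, $s\ge 0$, are random matrices and vectors on a common probability space, $a(s)\in\mathbb{R}$ is the gain, and $x(0)\in\mathbb{R}^n$ is the initial state. System (M): for $1\le i\le n$, $$x_i(s+1)=(1-a(s))x_i(s)+a(s)\sum_{j\in\mathcal{N}_i(s)}P_{ij}(s)\big[x_j(s)+f_{ji}(x(s))w_{ji}(s)\big],$$ where $\mathcal{N}_i(s)$ is the neighbor set of node $i$ at time $s$, $P_{ij}(s)$ is the weight of edge $(j,i)$ at time $s$, and $f_{ji}(x(s))w_{ji}(s)$ is a (state-dependent) noise. Setting $P_{ij}(s)=0$ for $j\notin\mathcal{N}_i(s)$ and $u_i(s):=\sum_{j\in\mathcal{N}_i(s)}P_{ij}(s)f_{ji}(x(s))w_{ji}(s)$, (M) takes the form $x(s+1)=(1-a(s))x(s)+a(s)[P(s)x(s)+u(s)]$. For $A\in\mathbb{R}^{n\times n}$ with eigenvalues $\lambda_i(A)$, $\widetilde{\rho}_{\max}(A):=\max_i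 \mathrm{Re}(\lambda_i(A))$. (A1): there exist a matrix $P\in\mathbb{R}^{n\times n}$ and a vector $u\in\mathbb{R}^n$ such that $\mathbb{E}[P(s)\,|\,x(s)]=P$ and $\mathbb{E}[u(s)\,|\,x(s)]=u$ for any $s\ge 0$ and $x(s)\in\mathbb{R}^n$; also $\mathbb{E}[\|P(s)\|_2^2\,|\,x(s)]$ and $\mathbb{E}[\|u(s)\|_2^2\,|\,x(s)]$ are uniformly bounded. (A2): $\{a(s)\}$ are non-negative real numbers independent of $\{x(s)\}$ with $\sum_{s=0}^\infty a(s)=\infty$ and $\sum_{s=0}^\infty a^2(s)<\infty$. $x(s)$ is mean-square convergent if there is an $n$-dimensional random vector $x$ with $\mathbb{E}\|x\|_2^2<\infty$ and $\lim_{s\to\infty}\mathbb{E}\|x(s)-x\|_2^2=0$. $x(s)$ asymptotically reaches consensus in mean square if $x(s)$ is mean-square convergent and $\lim_{s\to\infty}\mathbb{E}|x_i(s)-x_j(s)|=0$ for all $i,j\in\{1,\ldots,n\}$.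
   Formalization: In (A1) the conditional means of P(s) and u(s) are taken given x(0),...,x(s) rather than x(s) alone (they agree in the Markov case); with x(s) alone the claim fails, e.g. n=1, P=1 with persistent noise that is fair given x(s). *)

(* Defs.v *)
From HB Require Import structures.
From mathcomp Require Import all_boot all_order all_algebra.
From mathcomp Require Import all_classical all_reals all_analysis.
From mathcomp Require Import complex.

Set Implicit Arguments.
Unset Strict Implicit.
Unset Printing Implicit Defensive.

Import Order.TTheory GRing.Theory Num.Theory.
Import numFieldNormedType.Exports.

Local Open Scope classical_set_scope.
Local Open Scope ring_scope.

Section Norms.
Context {R : realType}.

Definition norm2 n (v : 'cV[R]_n) : R := Num.sqrt (\sum_i v i 0 ^+ 2).

Definition mxnorm2 n (A : 'M[R]_n) : R :=
  sup [set norm2 (A *m v) | v in [set v : 'cV[R]_n | norm2 v <= 1]].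

End Norms.

Section Spectrum.
Context {R : realType}.

(* The complex eigenvalues of A, each repeated according to its algebraic
   multiplicity: the roots of the (monic) characteristic polynomial. *)
Definition eigenvalues n (A : 'M[R]_n) : seq R[i] :=
  sval (closed_field_poly_normal
          (char_poly (map_mx (fun r : R => (r%:C)%C) A))).

(* For n > 0 the list of eigenvalues is nonempty and the default element of the
   maximum is the real part of one of them. *)
Definition rho_max n (A : 'M[R]_n) : R :=
  \big[Num.max/complex.Re (head 0 (eigenvalues A))]_(z <- eigenvalues A)
     complex.Re z.

End Spectrum.

Section Probability.
Context {d : measure_display} {T : measurableType d} {R : realType}.
Variable Pr : probability T R.

(* Z is a version of the conditional expectation of X given the
   sigma-algebra G. *)
Definition is_cond_exp (G : set (set T)) (X Z : T -> R) : Prop :=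
  [/\ Pr.-integrable setT (EFin \o X),
      Pr.-integrable setT (EFin \o Z),
      forall B : set R, measurable B -> G (Z @^-1` B) &
      forall A, G A ->
        (\int[Pr]_(w in A) (Z w)%:E = \int[Pr]_(w in A) (X w)%:E)%E].

Variable n : nat.
Implicit Types x u : nat -> T -> 'cV[R]_n.

Definition sigma_state x (s : nat) : set (set T) :=
  g_sigma_preimage (fun (i : 'I_n) w => x s w i 0).

Definition sigma_history x (s : nat) : set (set T) :=
  <<s \bigcup_(r in [set r | (r <= s)%N]) sigma_state x r >>.

Definition cond_exp_bounded (G : nat -> set (set T)) (X : nat -> T -> R) :=
  exists C : R, forall s : nat, exists2 Z : T -> R,
    is_cond_exp (G s) (X s) Z & {ae Pr, forall w, Z w <= C}.

Definition linear_system (a : nat -> R) (P : nat -> T -> 'M[R]_n) u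
    (x0 : 'cV[R]_n) x : Prop :=
  (forall w, x 0%N w = x0) /\
  (forall s w, x s.+1 w =
     (1 - a s) *: x s w + a s *: (P s w *m x s w + u s w)).

(* N s w i is the neighbor set of node i, W the edge weights,
   f j i (x s w) * noise s w j i the state-dependent noise on edge (j, i). *)
Definition multi_agent_system (a : nat -> R)
    (N : nat -> T -> 'I_n -> {set 'I_n}) (W : nat -> T -> 'M[R]_n)
    (f : 'I_n -> 'I_n -> 'cV[R]_n -> R) (noise : nat -> T -> 'M[R]_n)
    (x0 : 'cV[R]_n) x : Prop :=
  (forall w, x 0%N w = x0) /\
  (forall s w i, x s.+1 w i 0 =
     (1 - a s) * x s w i 0 + a s * \sum_(j in N s w i)
       W s w i j * (x s w j 0 + f j i (x s w) * noise s w j i)).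

Lemma multi_agent_system_linear a N W f noise (x0 : 'cV[R]_n) x :
  multi_agent_system a N W f noise x0 x ->
  linear_system a
    (fun s w => \matrix_(i, j) if j \in N s w i then W s w i j else 0)
    (fun s w => \col_i \sum_(j in N s w i)
                  W s w i j * (f j i (x s w) * noise s w j i))
    x0 x.
Proof.
case=> h0 hS; split=> // s w; apply/matrixP => i k; rewrite ord1 hS !mxE.
congr (_ + _ * _); rewrite [X in _ = X + _](_ : _ =
    \sum_(j in N s w i) W s w i j * x s w j 0).
  by rewrite -big_split; apply: eq_bigr => j _; rewrite mulrDr.
rewrite [RHS]big_mkcond; apply: eq_bigr => j _; rewrite mxE.
by case: ifP => // _; rewrite mul0r.
Qed.

(* The first moments are conditioned on x(0), ..., x(s).  Conditioning on x(s)
   alone, without the Markov property, would allow noise that is uncorrelated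
   with the current state but correlated with past increments, and then a
   simple eigenvalue 1 does not imply mean-square convergence, even for n = 1.
   When (P(s), u(s)) is conditionally independent of the past given x(s), the
   two conditionings agree. *)
Definition A1 x (P : nat -> T -> 'M[R]_n) u
    (Pbar : 'M[R]_n) (ubar : 'cV[R]_n) : Prop :=
  [/\ forall s i j,
        is_cond_exp (sigma_history x s) (fun w => P s w i j) (cst (Pbar i j)),
      forall s i,
        is_cond_exp (sigma_history x s) (fun w => u s w i 0) (cst (ubar i 0)),
      cond_exp_bounded (sigma_state x) (fun s w => mxnorm2 (P s w) ^+ 2) &
      cond_exp_bounded (sigma_state x) (fun s w => norm2 (u s w) ^+ 2)].

Definition ms_convergent x : Prop :=
  exists xlim : T -> 'cV[R]_n,
    [/\ forall i, measurable_fun setT (fun w => xlim w i 0),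
        ('E_Pr[fun w => (norm2 (xlim w) ^+ 2)%R] < +oo)%E &
        'E_Pr[fun w => (norm2 (x s w - xlim w) ^+ 2)%R]%E @[s --> \oo] --> 0%E].

Definition ms_consensus x : Prop :=
  ms_convergent x /\
  forall i j : 'I_n,
    'E_Pr[fun w => `|x s w i 0 - x s w j 0|%R]%E @[s --> \oo] --> 0%E.

End Probability.

Definition A2 {R : realType} (a : nat -> R) : Prop :=
  [/\ forall s, 0 <= a s,
      series a n @[n --> \oo] --> +oo &
      cvgn (series (fun s => a s ^+ 2))].

(* Main.v *)
Require Import Defs.
From mathcomp Require Import all_boot all_order all_algebra.
From mathcomp Require Import all_classical all_reals all_analysis.
From mathcomp Require Import measurable_realfun complex ring lra.

(** Write [Q = P - 1], so that [x(s+1) = x(s) + a(s) eta(s)] where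
    [eta(s) = P(s) x(s) + u(s) - x(s)] has conditional mean [Q x(s)] given the
    history, and [E |eta(s)|^2 <= C (1 + E |x(s)|^2)].

    Sufficiency.  Both spectral conditions provide a real matrix [L], a row [p]
    and [c > 0] with [<L x, L Q x> <= - c |L x|^2], [p Q = 0] and
    [|x - (p x) 1|^2 <= K |L x|^2]: for condition i) take [p = 0] and for [L] the
    real form of [D S], where [S] puts [P] in complex Schur form and the diagonal
    matrix [D] makes the off-diagonal entries small; for condition ii) apply i)
    to the dynamics of the differences [x_i - x_0].  Then
    [E |L x|^2 + E (p x)^2] stays bounded because [a] is square summable,
    [E |L x|^2] tends to 0 because [a] is not summable, and [p x] is an L2-bounded
    martingale, hence converges in L2.

    Necessity.  [E x(s) = M(s) x(0)] with [M(s) = \prod_(k < s) (1 + a(k) Q)].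
    On the plane spanned by the real and imaginary parts of an eigenvector whose
    eigenvalue has real part at least 1, the squared length of any pair of values
    of a linear functional is nondecreasing in [s].  As the differences of the
    entries of [M(s) x(0)] vanish, such an eigenvector of [P] is constant, and the
    dynamics of the differences has no such eigenvector at all. *)

Set Implicit Arguments.
Unset Strict Implicit.
Unset Printing Implicit Defensive.

Import Order.TTheory GRing.Theory Num.Theory.
Import numFieldNormedType.Exports.

Local Open Scope classical_set_scope.
Local Open Scope ring_scope.

(** * Scalar recursions *)

Section Recursions.
Context {R : realType}.
Implicit Types a v : nat -> R.

Lemma series_sqr_le_lim a : cvgn (series (fun s => a s ^+ 2)) ->
  forall s, series (fun s => a s ^+ 2) s <= limn (series (fun s => a s ^+ 2)).
Proof.
move=> ca s; apply: nondecreasing_cvgn_le => //.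
by apply/nondecreasing_seqP => k; rewrite seriesSr lerDl sqr_ge0.
Qed.

(** Discrete Gronwall: each step multiplies [1 + v] by at most
    [1 + C * a s ^+ 2 <= expR (C * a s ^+ 2)], and the exponents have bounded partial sums. *)
Lemma recursion_bounded a v (C : R) : 0 <= C -> (forall s, 0 <= v s) ->
  (forall s, v s.+1 <= v s + C * a s ^+ 2 * (1 + v s)) ->
  cvgn (series (fun s => a s ^+ 2)) -> exists B, forall s, v s <= B.
Proof.
move=> C0 v0 hv ca.
have hexp s : 1 + v s <= (1 + v 0%N) * expR (C * series (fun s => a s ^+ 2) s).
  elim: s => [|s ih]; first by rewrite seriesEnat/= big_geq// mulr0 expR0 mulr1.
  have h1 : 1 + v s.+1 <= (1 + C * a s ^+ 2) * (1 + v s) by have := hv s; lra.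
  apply: (le_trans h1); rewrite seriesSr [X in expR X]mulrDr expRD mulrA [leRHS]mulrC.
  apply: ler_pM => //.
  - by rewrite addr_ge0// mulr_ge0// sqr_ge0.
  - by rewrite addr_ge0.
  - exact: expR_ge1Dx.
exists ((1 + v 0%N) * expR (C * limn (series (fun s => a s ^+ 2)))) => s.
apply: le_trans (_ : 1 + v s <= _); first by rewrite lerDr.
apply: (le_trans (hexp s)); rewrite ler_pM2l; last by rewrite ltr_pwDl.
by rewrite ler_expR ler_wpM2l// series_sqr_le_lim.
Qed.

Lemma recursion_cvg0 a v (c K : R) : 0 < c -> 0 <= K -> A2 a ->
  (forall s, 0 <= v s) ->
  (forall s, v s.+1 <= v s - c * a s * v s + K * a s ^+ 2) ->
  v @ \oo --> 0.
Proof.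
move=> c0 K0 [a0 ay ca] v0 hv.
pose S := series (fun s => a s ^+ 2).
have SE s : S s.+1 = S s + a s ^+ 2 by rewrite /S seriesSr.
(* [b] is nonincreasing, so [v] converges; a positive limit would make
   [\sum a s * v s] diverge. *)
pose b s := v s - K * S s.
have cb : cvgn b.
  apply: nonincreasing_is_cvgn.
    apply/nonincreasing_seqP => s; rewrite /b SE.
    have : 0 <= c * a s * v s by rewrite !mulr_ge0// ltW.
    by have := hv s; lra.
  exists (- (K * limn S)) => _ [s _ <-]; rewrite /b.
  have : K * S s <= K * limn S by rewrite ler_wpM2l// series_sqr_le_lim.
  by have := v0 s; lra.
have cv : cvgn v.
  rewrite (_ : v = b \+ (fun s => K * S s)).
    by apply: is_cvgD => //; exact: is_cvgMr.
  by apply/funext => s /=; rewrite /b subrK.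
have l0 : 0 <= limn v by apply: limr_ge => //; near=> s.
have [l00|lneq0] := eqVneq (limn v) 0; first by have : v @ \oo --> limn v := cv; rewrite l00.
have lp : 0 < limn v by rewrite lt0r lneq0.
exfalso.
have : \forall s \near \oo, limn v / 2 < v s.
  apply: (cvgr_gt (limn v)) => //.
  lra.
move=> [N _ hN].
(* The recursion summed from [N] on: there [v] stays above half its limit, so step [k] removes at
   least [c * (limn v / 2) * a k]. *)
have hd s : v (N + s)%N + c * (limn v / 2) * (series a (N + s)%N - series a N) <=
    v N + K * (S (N + s)%N - S N).
  elim: s => [|s ih]; first by rewrite addn0 !subrr !mulr0 !addr0.
  rewrite addnS SE seriesSr.
  have h1 := hv (N + s)%N.
  have h2 : c * a (N + s)%N * (limn v / 2) <= c * a (N + s)%N * v (N + s)%N.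
    apply: ler_wpM2l; first by rewrite mulr_ge0// ltW.
    by apply: ltW; apply: hN => /=; rewrite leq_addr.
  by lra.
pose M := v N + K * limn S.
have S0 s : 0 <= S s by rewrite /S/= seriesEnat /= sumr_ge0// => i _; rewrite sqr_ge0.
have hM s : c * (limn v / 2) * (series a (N + s)%N - series a N) <= M.
  have h1 := hd s.
  have h2 : K * S (N + s)%N <= K * limn S by rewrite ler_wpM2l// series_sqr_le_lim.
  have h3 : 0 <= K * S N by rewrite mulr_ge0.
  have h4 := v0 (N + s)%N.
  by rewrite /M; lra.
have cl : 0 < c * (limn v / 2) by rewrite mulr_gt0// divr_gt0.
(* The threshold is exactly the value of [series a] beyond which [hM] fails. *)
move/cvgryPgt : ay => /(_ (M / (c * (limn v / 2)) + series a N)) [N' _ hN'].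
have := hN' (N + N')%N (leq_addl _ _).
have := hM N'; rewrite mulrC -ler_pdivlMr//.
by lra.
Unshelve. all: by end_near. Qed.

End Recursions.
(** * Lyapunov forms *)

Section QuadraticForms.
Context {R : realType}.

Definition dot m (u v : 'cV[R]_m) : R := \sum_i u i 0 * v i 0.
Definition sqn m (u : 'cV[R]_m) : R := dot u u.

Lemma dotC m (u v : 'cV[R]_m) : dot u v = dot v u.
Proof. by apply: eq_bigr => i _; rewrite mulrC. Qed.

Lemma dotDl m (u v w : 'cV[R]_m) : dot (u + v) w = dot u w + dot v w.
Proof. by rewrite -big_split; apply: eq_bigr => i _; rewrite mxE mulrDl. Qed.

Lemma dotZl m a (u w : 'cV[R]_m) : dot (a *: u) w = a * dot u w.
Proof. by rewrite mulr_sumr; apply: eq_bigr => i _; rewrite mxE mulrA. Qed.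

Lemma dotDr m (u v w : 'cV[R]_m) : dot w (u + v) = dot w u + dot w v.
Proof. by rewrite dotC dotDl !(dotC w). Qed.

Lemma dotZr m a (u w : 'cV[R]_m) : dot w (a *: u) = a * dot w u.
Proof. by rewrite dotC dotZl (dotC w). Qed.

Lemma sqn_ge0 m (u : 'cV[R]_m) : 0 <= sqn u.
Proof. by apply: sumr_ge0 => i _; rewrite -expr2 sqr_ge0. Qed.

Lemma sqnE m (u : 'cV[R]_m) : sqn u = \sum_i u i 0 ^+ 2.
Proof. by apply: eq_bigr => i _; rewrite expr2. Qed.

Lemma sqnD_le m (u v : 'cV[R]_m) : sqn (u + v) <= 2 * sqn u + 2 * sqn v.
Proof.
rewrite !sqnE !mulr_sumr -big_split; apply: ler_sum => i _ /=; rewrite mxE.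
by have := sqr_ge0 (u i 0 - v i 0); nra.
Qed.

Lemma sqr_le_sqn m (u : 'cV[R]_m) i : u i 0 ^+ 2 <= sqn u.
Proof. by rewrite sqnE (bigD1 i)//= lerDl sumr_ge0// => j _; rewrite sqr_ge0. Qed.

(** Cauchy-Schwarz against the constant vector, from [f i * f j <= (f i ^+ 2 + f j ^+ 2) / 2]. *)
Lemma sqr_sum_le m (f : 'I_m -> R) :
  (\sum_i f i) ^+ 2 <= m%:R * \sum_i f i ^+ 2.
Proof.
rewrite expr2 mulr_suml.
apply: (@le_trans _ _ (\sum_i \sum_j (f i ^+ 2 + f j ^+ 2) / 2)).
  apply: ler_sum => i _; rewrite mulr_sumr; apply: ler_sum => j _.
  by have := sqr_ge0 (f i - f j); nra.
have -> : \sum_i \sum_j (f i ^+ 2 + f j ^+ 2) / 2 =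
    \sum_i (m%:R * (f i ^+ 2 / 2)) + \sum_(i < m) \sum_j f j ^+ 2 / 2.
  rewrite -big_split; apply: eq_bigr => i _ /=.
  under eq_bigr do rewrite mulrDl.
  by rewrite big_split/= sumr_const card_ord mulr_natl.
rewrite sumr_const card_ord -mulr_natl -!mulr_sumr -!mulr_suml.
by lra.
Qed.

Lemma sqn_mulmx_le m p (A : 'M[R]_(m, p)) :
  exists2 K, 0 <= K & forall v, sqn (A *m v) <= K * sqn v.
Proof.
(* A multiple of the squared Frobenius norm; the factor [p] comes from applying [sqr_sum_le] to each
   row. *)
exists (p%:R * \sum_i \sum_j A i j ^+ 2) => [|v].
  by rewrite mulr_ge0// sumr_ge0// => i _; rewrite sumr_ge0// => j _; rewrite sqr_ge0.
rewrite [leLHS]sqnE -mulrA mulr_suml mulr_sumr; apply: ler_sum => i _.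
rewrite mxE; apply: (le_trans (sqr_sum_le _)); rewrite ler_wpM2l//.
rewrite mulr_suml; apply: ler_sum => j _.
by rewrite exprMn ler_wpM2l ?sqr_ge0// sqr_le_sqn.
Qed.

Lemma norm2_sqr n (v : 'cV[R]_n) : norm2 v ^+ 2 = sqn v.
Proof. by rewrite sqnE /norm2 sqr_sqrtr// sumr_ge0// => i _; rewrite sqr_ge0. Qed.

End QuadraticForms.

(** * Complex Schur form and dissipativity of nearly diagonal matrices *)

Section SchurForm.
Context {R : realType}.
Local Notation C := R[i].
Local Notation Re := (@complex.Re R).
Local Notation Im := (@complex.Im R).
Local Notation complexmx := (map_mx (real_complex R)).

Lemma eigenvaluesP n (A : 'M[R]_n) :
  char_poly (complexmx A) = \prod_(z <- eigenvalues A) ('X - z%:P).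
Proof.
rewrite /eigenvalues; case: closed_field_poly_normal => /= s hs.
by rewrite {1}hs (monicP (char_poly_monic _)) scale1r.
Qed.

Lemma mem_eigenvalues n (A : 'M[R]_n) z :
  (z \in eigenvalues A) = root (char_poly (complexmx A)) z.
Proof. by rewrite eigenvaluesP root_prod_XsubC. Qed.

Lemma Re_sum I (r : seq I) (F : I -> C) : Re (\sum_(i <- r) F i) = \sum_(i <- r) Re (F i).
Proof. by apply: (big_morph Re) => // -[? ?] [? ?]. Qed.

Lemma Im_sum I (r : seq I) (F : I -> C) : Im (\sum_(i <- r) F i) = \sum_(i <- r) Im (F i).
Proof. by apply: (big_morph Im) => // -[? ?] [? ?]. Qed.

(** The left side is the real part of [conj(z) g w]. It splits into a [Re g] part and an [Im g]
    part, each at most [d] times half of [|z|^2 + |w|^2]. *)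
Lemma dissipative_term (g z w : C) (d : R) :
  `|Re g| <= d -> `|Im g| <= d ->
  Re z * Re (g * w) + Im z * Im (g * w) <=
    d * (Re z ^+ 2 + Im z ^+ 2 + (Re w ^+ 2 + Im w ^+ 2)).
Proof.
case: g z w => [g h] [a b] [e f] /= hg hh.
have h1 : g * (a * e + b * f) <= d * ((a ^+ 2 + b ^+ 2 + (e ^+ 2 + f ^+ 2)) / 2).
  apply: (le_trans (ler_norm _)); rewrite normrM; apply: ler_pM => //.
  rewrite ler_norml; apply/andP; split.
    by have := sqr_ge0 (a + e); have := sqr_ge0 (b + f); nra.
  by have := sqr_ge0 (a - e); have := sqr_ge0 (b - f); nra.
have h2 : h * (b * e - a * f) <= d * ((a ^+ 2 + b ^+ 2 + (e ^+ 2 + f ^+ 2)) / 2).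
  apply: (le_trans (ler_norm _)); rewrite normrM; apply: ler_pM => //.
  rewrite ler_norml; apply/andP; split.
    by have := sqr_ge0 (b + e); have := sqr_ge0 (a - f); nra.
  by have := sqr_ge0 (b - e); have := sqr_ge0 (a + f); nra.
lra.
Qed.

Lemma dissipative_diag_term (g z : C) (mu : R) : Re g <= - mu ->
  Re z * Re (g * z) + Im z * Im (g * z) <= - (mu * (Re z ^+ 2 + Im z ^+ 2)).
Proof.
rewrite -mulNr; case: g z => [g h] [a b] /= hg.
have h1 := ler_wpM2r (addr_ge0 (sqr_ge0 a) (sqr_ge0 b)) hg.
by apply: (le_trans _ h1); rewrite le_eqVlt; apply/orP; left; apply/eqP; ring.
Qed.

(** A diagonal dominance estimate: the diagonal contributes at most [- mu |z|^2], and the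
    off-diagonal pairs together at most [2 n d |z|^2]. *)
Lemma near_diag_dissipative n (G : 'M[C]_n) (mu d : R) (z : 'cV[C]_n) : 0 <= d ->
  (forall i, Re (G i i) <= - mu) ->
  (forall i j, i != j -> `|Re (G i j)| <= d /\ `|Im (G i j)| <= d) ->
  \sum_i (Re (z i 0) * Re ((G *m z) i 0) + Im (z i 0) * Im ((G *m z) i 0)) <=
  (2 * n%:R * d - mu) * \sum_i (Re (z i 0) ^+ 2 + Im (z i 0) ^+ 2).
Proof.
move=> d0 hdiag hoff; set q := fun i => Re (z i 0) ^+ 2 + Im (z i 0) ^+ 2.
have q0 i : 0 <= q i by rewrite addr_ge0 ?sqr_ge0.
apply: (@le_trans _ _ (\sum_i (\sum_j d * (q i + q j) - mu * q i))).
  apply: ler_sum => i _; rewrite mxE Re_sum Im_sum !mulr_sumr -big_split/=.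
  rewrite (bigD1 i)//= [X in _ <= X - _](bigD1 i)//= [leRHS]addrAC.
  apply: lerD; last first.
    by apply: ler_sum => j ji; rewrite eq_sym in ji; have [] := hoff _ _ ji; exact: dissipative_term.
  apply: le_trans (dissipative_diag_term _ (hdiag i)) _.
  by rewrite lerDr mulr_ge0// addr_ge0.
rewrite sumrB -mulr_sumr mulrBl lerD2r.
under eq_bigr do rewrite -mulr_sumr big_split/= sumr_const card_ord -mulr_natl.
rewrite -mulr_sumr big_split/= sumr_const card_ord -mulr_sumr -mulr_natl.
rewrite -[X in _ <= _ * X]/(\sum_i q i) -[X in _ + X]mulr_natl; move: (\sum_i q i) => Q.
by rewrite le_eqVlt; apply/orP; left; apply/eqP; ring.
Qed.

Lemma pos_lower_bound n (f : 'I_n -> R) : (forall i, 0 < f i) ->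
  exists2 mu, 0 < mu & forall i, mu <= f i.
Proof.
(* The default 1 keeps the minimum positive when [n = 0]. *)
move=> f0; exists (\big[Num.min/1]_i f i); last by move=> i; exact: bigmin_le_cond.
by apply/bigmin_gtP; split.
Qed.

Lemma char_poly_conj (F : fieldType) n (P A T : 'M[F]_n) : P \in unitmx ->
  P *m A = T *m P -> char_poly A = char_poly T.
Proof.
(* Similarity is used without inverses: the relation passes to ['X - A] and ['X - T], and the
   nonzero constant [\det P] cancels. *)
move=> Pu PA; apply: (@mulfI _ (\det P)%:P).
  by rewrite polyC_eq0 -unitfE -unitmxE.
have : map_mx polyC P *m char_poly_mx A = char_poly_mx T *m map_mx polyC P.
  by rewrite /char_poly_mx mulmxBr mulmxBl -!map_mxM PA scalar_mxC.
move/(congr1 determinant); rewrite !det_mulmx det_map_mx => ->.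
by rewrite mulrC.
Qed.

(** Simultaneous triangularization applied to the single matrix [A]. Since [T] is lower triangular,
    its diagonal entries are roots of the common characteristic polynomial. *)
Lemma schur_form n (A : 'M[R]_n) : exists (P T : 'M[C]_n),
  [/\ P \in unitmx, P *m complexmx A = T *m P, is_trig_mx T &
      forall i, T i i \in eigenvalues A].
Proof.
have [|P Pu] := @cotrigonalization _ _ [:: complexmx A].
  by move=> B1 B2; rewrite !inE => /eqP -> /eqP ->.
move/allP => /(_ _ (mem_head _ _)) /= hT.
have Pun := unitarymx_unit Pu.
have PA : P *m complexmx A = conjmx P (complexmx A) *m P.
  by rewrite conjumx// mulmxKV.
exists P, (conjmx P (complexmx A)); split => // i.
rewrite mem_eigenvalues (char_poly_conj Pun PA) char_poly_trig//.
by rewrite (bigD1 i)//= rootM root_XsubC eqxx.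
Qed.

End SchurForm.

(** * From the complex Schur form to a real Lyapunov form *)

Section RealLyapunovForm.
Context {R : realType}.
Local Notation C := R[i].
Local Notation Re := (@complex.Re R).
Local Notation Im := (@complex.Im R).
Local Notation complexmx := (map_mx (real_complex R)).

Lemma map_Re_mulmx m n p (A : 'M[C]_(m, n)) (B : 'M[C]_(n, p)) :
  map_mx Re (A *m B) = map_mx Re A *m map_mx Re B - map_mx Im A *m map_mx Im B.
Proof.
apply/matrixP => i j; rewrite !mxE Re_sum -sumrB; apply: eq_bigr => k _.
by rewrite !mxE; case: (A i k) (B k j) => [? ?] [? ?].
Qed.

Lemma map_Im_mulmx m n p (A : 'M[C]_(m, n)) (B : 'M[C]_(n, p)) :
  map_mx Im (A *m B) = map_mx Re A *m map_mx Im B + map_mx Im A *m map_mx Re B.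
Proof.
apply/matrixP => i j; rewrite !mxE Im_sum -big_split; apply: eq_bigr => k _.
by rewrite !mxE; case: (A i k) (B k j) => [? ?] [? ?].
Qed.

Lemma map_Re_complexmx m n (A : 'M[R]_(m, n)) : map_mx Re (complexmx A) = A.
Proof. by apply/matrixP => i j; rewrite !mxE. Qed.

Lemma map_Im_complexmx m n (A : 'M[R]_(m, n)) : map_mx Im (complexmx A) = 0.
Proof. by apply/matrixP => i j; rewrite !mxE. Qed.

(** The identification of [C^m] with [R^(2m)], under which [dot] is the real part of the Hermitian
    product. *)
Definition realify m n (S : 'M[C]_(m, n)) : 'M[R]_(m + m, n) :=
  col_mx (map_mx Re S) (map_mx Im S).

Lemma realify_mulmx m n p (S : 'M[C]_(m, n)) (x : 'M[R]_(n, p)) :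
  realify S *m x = realify (S *m complexmx x).
Proof.
rewrite /realify mul_col_mx map_Re_mulmx map_Im_mulmx map_Re_complexmx.
by rewrite map_Im_complexmx !mulmx0 subr0 add0r.
Qed.

Lemma dot_realify n (z w : 'cV[C]_n) : dot (realify z) (realify w) =
  \sum_i (Re (z i 0) * Re (w i 0) + Im (z i 0) * Im (w i 0)).
Proof.
rewrite /dot big_split_ord big_split/=; congr (_ + _); apply: eq_bigr => i _.
  by rewrite !col_mxEu !mxE.
by rewrite !col_mxEd !mxE.
Qed.

Lemma lyapunov_form n (A : 'M[R]_n) :
  (forall z, z \in eigenvalues A -> Re z < 1) ->
  exists (L : 'M[R]_(n + n, n)) (L' : 'M[R]_(n, n + n)) (c : R),
    [/\ 0 < c, L' *m L = 1%:M &
        forall x, dot (L *m x) (L *m ((A - 1%:M) *m x)) <= - c * sqn (L *m x)].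
Proof.
move=> hA; have [P [T [Pu PA Ttrig Tii]]] := schur_form A.
(* [mu] is a uniform spectral gap; half of it is left for [c] once the off-diagonal terms are
   absorbed. *)
have [mu mu0 hmu] : exists2 mu, 0 < mu & forall i, mu <= 1 - Re (T i i).
  by apply: pos_lower_bound => i; rewrite subr_gt0 hA.
pose M := \sum_i \sum_j (`|Re (T i j)| + `|Im (T i j)|).
have M0 : 0 <= M by rewrite !sumr_ge0// => i _; rewrite sumr_ge0.
have hM i j : `|Re (T i j)| + `|Im (T i j)| <= M.
  rewrite /M (bigD1 i)//= (bigD1 j)//= -addrA lerDl addr_ge0// sumr_ge0// => k _.
  by rewrite sumr_ge0.
(* Chosen so that [2 * n%:R * d <= mu / 2]; [n.+1] avoids dividing by zero. *)
pose d := mu / (4 * (n.+1)%:R).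
have d0 : 0 < d by rewrite divr_gt0// mulr_gt0.
(* The second argument gives [e * M <= d]; the cap at 1 makes every positive power of [e] at most
   [e]. *)
pose e := Num.min 1 (d / (M + 1)).
have M1 : 0 < M + 1 by rewrite ltr_wpDl.
have e0 : 0 < e by rewrite lt_min ltr01 divr_gt0.
have e1 : e <= 1 by rewrite ge_min lexx.
have eM : e * M <= d.
  apply: (@le_trans _ _ (d / (M + 1) * M)).
    by rewrite ler_wpM2r// ge_min lexx orbT.
  by rewrite mulrAC ler_pdivrMr// ler_wpM2l ?ltW// ltrDl.
(* Conjugation by [diag (e ^+ i)] multiplies the entries of [T] below the diagonal
   by positive powers of [e]. *)
pose f (i : 'I_n) : C := (e%:C)%C ^+ i.
have ec0 : (e%:C)%C != 0 by apply/eqP => /(@complexI R e 0) e00; rewrite e00 ltxx in e0.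
have f0 i : f i != 0 by rewrite expf_neq0.
pose D := diag_mx (\row_i f i); pose D' := diag_mx (\row_i (f i)^-1).
have D'D : D' *m D = 1%:M.
  rewrite mulmx_diag -diag_const_mx; congr diag_mx.
  by apply/rowP => i; rewrite !mxE mulVf.
have DD' : D *m D' = 1%:M by apply: mulmx1C.
pose S := D *m P; pose S' := invmx P *m D'.
have S'S : S' *m S = 1%:M by rewrite /S /S' mulmxA -(mulmxA _ D') D'D mulmx1 mulVmx.
pose G := D *m (T - 1%:M) *m D'.
have SQ : S *m complexmx (A - 1%:M) = G *m S.
  rewrite map_mxB map_mx1 /S /G -!mulmxA (mulmxA D') D'D mul1mx mulmxBr PA.
  by rewrite mulmx1 mulmxBl mul1mx.
have GE i j : G i j = (T i j - (i == j)%:R) * (f i / f j).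
  by rewrite /G mul_mx_diag mxE mul_diag_mx !mxE; ring.
(* The product of the second witness with [realify S] is the real part of [S' *m S], hence the minus
   sign. *)
exists (realify S), (row_mx (map_mx Re S') (- map_mx Im S')), (mu / 2); split.
- by rewrite divr_gt0.
- rewrite mul_row_col mulNmx -map_Re_mulmx S'S.
  by apply/matrixP => i j; rewrite !mxE; case: (i == j).
move=> x; rewrite /sqn !realify_mulmx map_mxM mulmxA SQ -mulmxA !dot_realify.
apply: le_trans (@near_diag_dissipative _ _ G mu d _ (ltW d0) _ _) _.
- move=> i; rewrite GE eqxx divff// mulr1 raddfB/=.
  by have := hmu i; lra.
- move=> i j ij; rewrite GE (negbTE ij) subr0.
  have [lij|] := ltnP i j; first by rewrite (is_trig_mxP Ttrig)// mul0r /= normr0 ltW.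
  rewrite leq_eqVlt eq_sym val_eqE (negbTE ij)/= => ji.
  have -> : f i / f j = (e ^+ (i - j))%:C%C.
    by rewrite /f -exprB ?unitfE// 1?ltnW// rmorphXn.
  have em : 0 <= e ^+ (i - j) <= e.
    rewrite exprn_ge0 ?(ltW e0)//=; have : (0 < i - j)%N by rewrite subn_gt0.
    by case: (i - j)%N => // k _; rewrite exprS ler_piMr// ?exprn_ile1// ltW.
  move: (hM i j) em; case: (T i j) => [g h] /= hgh; move: (e ^+ _) => q /andP[q0 qe].
  rewrite !mulr0 subr0 add0r !normrM (ger0_norm q0).
  have := normr_ge0 g; have := normr_ge0 h => h1 h2.
  have h3 : `|g| <= M by apply: le_trans hgh; rewrite lerDl.
  have h4 : `|h| <= M by apply: le_trans hgh; rewrite lerDr.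
  split; apply: le_trans eM; rewrite mulrC; exact: ler_pM.
have -> : \sum_i (Re ((S *m complexmx x) i 0) * Re ((S *m complexmx x) i 0) + 
    Im ((S *m complexmx x) i 0) * Im ((S *m complexmx x) i 0)) =
   \sum_i (Re ((S *m complexmx x) i 0) ^+ 2 + Im ((S *m complexmx x) i 0) ^+ 2).
  by apply: eq_bigr => i _; rewrite !expr2.
apply: ler_wpM2r; first by rewrite sumr_ge0// => i _; rewrite addr_ge0 ?sqr_ge0.
have -> : 2 * n%:R * d = n%:R / n.+1%:R * mu / 2.
  have : n.+1%:R != 0 :> R by rewrite pnatr_eq0.
  by rewrite /d; move: n.+1%:R => N N0; field.
have : n%:R / n.+1%:R <= 1 :> R by rewrite ler_pdivrMr// mul1r ler_nat.
move: (n%:R / n.+1%:R) => r h; have h2 := ler_wpM2r (ltW mu0) h.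
by lra.
Qed.

End RealLyapunovForm.
(** * The dynamics of differences *)

Section Differences.
Context {R : realType}.
Local Notation C := R[i].
Local Notation Re := (@complex.Re R).
Local Notation Im := (@complex.Im R).
Local Notation complexmx := (map_mx (real_complex R)).
Local Notation ones n := (const_mx 1 : 'cV[R]_n).

Lemma size_eigenvalues n (A : 'M[R]_n) : size (eigenvalues A) = n.
Proof.
have /eqP := congr1 (fun p : {poly C} => size p) (eigenvaluesP A).
by rewrite size_char_poly size_prod_XsubC eqSS => /eqP.
Qed.

Lemma char_poly_tr (F : fieldType) n (A : 'M[F]_n) : char_poly A^T = char_poly A.
Proof.
rewrite /char_poly -[RHS]det_tr /char_poly_mx; congr determinant.
by apply/matrixP => i j; rewrite !mxE eq_sym.
Qed.

(** [v] and [w] are the real and imaginary parts of a complex eigenvector. The transpose turns the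
    row eigenvectors of [eigenvalueP] into columns. *)
Lemma eigenvector_pair n (A : 'M[R]_n) z : z \in eigenvalues A ->
  exists v w : 'cV[R]_n, [/\ (v != 0) || (w != 0),
    A *m v = Re z *: v - Im z *: w & A *m w = Im z *: v + Re z *: w].
Proof.
rewrite mem_eigenvalues => hz.
have : eigenvalue (complexmx A)^T z.
  by rewrite eigenvalue_root_char char_poly_tr.
case/eigenvalueP => u hu u0; pose y := u^T.
have hy : complexmx A *m y = z *: y.
  by rewrite /y -[complexmx A]trmxK -trmx_mul hu linearZ.
exists (map_mx Re y), (map_mx Im y); split.
- rewrite -negb_and; apply: contra u0 => /andP[/eqP h1 /eqP h2]; apply/eqP.
  apply: trmx_inj; rewrite -/y trmx0; apply/matrixP => i j.
  move/matrixP/(_ i j) : h1; move/matrixP/(_ i j) : h2; rewrite !mxE.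
  by case: (u _ _) => ? ? /= -> ->.
- have := congr1 (map_mx Re) hy.
  rewrite map_Re_mulmx map_Re_complexmx map_Im_complexmx mul0mx subr0 => ->.
  by apply/matrixP => i j; rewrite !mxE; case: (z) (u _ _) => [? ?] [? ?].
- have := congr1 (map_mx Im) hy.
  rewrite map_Im_mulmx map_Re_complexmx map_Im_complexmx mul0mx addr0 => ->.
  by apply/matrixP => i j; rewrite !mxE; case: (z) (u _ _) => [? ?] [? ?]; rewrite addrC.
Qed.

Lemma rho_max_lt1 n (A : 'M[R]_n) : (0 < n)%N ->
  rho_max A < 1 <-> forall z, z \in eigenvalues A -> Re z < 1.
Proof.
move=> n0; rewrite /rho_max.
have hbig (x0 : R) (s : seq C) :
    \big[Num.max/x0]_(z <- s) Re z < 1 = (x0 < 1) && all (fun z => Re z < 1) s.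
  elim: s => [|z s ih]; first by rewrite big_nil andbT.
  by rewrite big_cons gt_max ih /= andbCA.
(* On a nonempty list the default of the maximum is the real part of the first eigenvalue, so it
   adds no condition. *)
rewrite hbig; have : size (eigenvalues A) != 0%N by rewrite size_eigenvalues -lt0n.
case: (eigenvalues A) => // z s _; rewrite [head _ _]/=.
split=> [/andP[_ /allP h] //|h].
by apply/andP; split; [exact: h (mem_head _ _)|exact/allP].
Qed.

(* The dynamics induced on the differences [x_i - x_0], which are the
   coordinates [diff_mx m *m x]. *)
Definition diff_mx m : 'M[R]_(m, 1 + m) := row_mx (- const_mx 1) 1%:M.
Definition diff_part m (P : 'M[R]_(1 + m)) : 'M[R]_m :=
  drsubmx P - const_mx 1 *m ursubmx P.

Lemma row_sums n (P : 'M[R]_n) :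
  (forall i, \sum_(j < n) P i j = 1) <-> P *m ones n = ones n.
Proof.
split=> [h|/matrixP h i].
  apply/matrixP => i j; rewrite !mxE -[RHS](h i); apply: eq_bigr => k _.
  by rewrite mxE mulr1.
have := h i 0; rewrite !mxE => <-; apply: eq_bigr => k _.
by rewrite mxE mulr1.
Qed.

Section Blocks.
Variables (m : nat) (P : 'M[R]_(1 + m)).
Hypothesis P1 : P *m ones (1 + m) = ones (1 + m).

Lemma ulsubmx_row_sums : ulsubmx P = 1%:M - ursubmx P *m ones m.
Proof.
move: P1; rewrite -[ones (1 + m)]vsubmxK -{1}[P]submxK mul_block_col.
case/eq_col_mx => + _.
have -> : usubmx (ones (1 + m)) = 1%:M by apply/matrixP => i j; rewrite !mxE !ord1.
have -> : dsubmx (ones (1 + m)) = ones m by apply/matrixP => i j; rewrite !mxE.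
by rewrite mulmx1 => h; apply: (addIr (ursubmx P *m ones m)); rewrite subrK; exact: h.
Qed.

Lemma dlsubmx_row_sums : dlsubmx P = ones m - drsubmx P *m ones m.
Proof.
move: P1; rewrite -[ones (1 + m)]vsubmxK -{1}[P]submxK mul_block_col.
case/eq_col_mx => _ +.
have -> : usubmx (ones (1 + m)) = 1%:M by apply/matrixP => i j; rewrite !mxE !ord1.
have -> : dsubmx (ones (1 + m)) = ones m by apply/matrixP => i j; rewrite !mxE.
by rewrite mulmx1 => h; apply: (addIr (drsubmx P *m ones m)); rewrite subrK; exact: h.
Qed.

(** The constant vectors form the kernel of [x |-> diff_mx m *m x]; as [P] fixes them, it acts on
    the quotient, and [diff_part P] is that action. *)
Lemma diff_mx_mul : diff_mx m *m P = diff_part P *m diff_mx m.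
Proof.
rewrite -[X in _ *m X = _]submxK /diff_mx /diff_part mul_row_block mul_mx_row.
rewrite !mul1mx mulmx1 !mulNmx ulsubmx_row_sums dlsubmx_row_sums; congr row_mx; last by rewrite addrC.
rewrite mulmxBr mulmx1 mulmxN mulmxBl -!mulmxA.
move: (ones m) (const_mx 1 *m _) (drsubmx P *m _) => o A B.
by rewrite !opprB addrA subrK.
Qed.

Lemma char_poly_diff_part : char_poly P = ('X - 1%:P) * char_poly (diff_part P).
Proof.
(* Change to the coordinates [x_0] and [x_i - x_0], in which [P] becomes the block triangular
   [T]. *)
pose B : 'M[R]_(1 + m) := block_mx 1%:M 0 (- const_mx 1) 1%:M.
pose T : 'M[R]_(1 + m) := block_mx 1%:M (ursubmx P) 0 (diff_part P).
have Bu : B \in unitmx by rewrite unitmxE det_lblock !det1 mulr1 unitr1.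
rewrite (@char_poly_conj _ _ B P T)//.
  rewrite /char_poly /char_poly_mx /T map_block_mx map_mx0 map_mx1.
  rewrite (@scalar_mx_block _ 1 m 'X) opp_block_mx add_block_mx oppr0 addr0 det_ublock.
  by rewrite det_mx11 !mxE eqxx mulr1n.
have := diff_mx_mul; rewrite /diff_mx -{1}[P]submxK mul_row_block mul_mx_row.
case/eq_row_mx => h1 h2.
rewrite /B /T -{1}[P]submxK !mulmx_block h1 h2 !mul0mx !mul1mx !addr0.
by rewrite !add0r !mulmx1 [X in _ = block_mx (_ + X) _ _ _]mulmxN ulsubmx_row_sums.
Qed.

Lemma perm_eigenvalues_diff :
  perm_eq (eigenvalues P) (1 :: eigenvalues (diff_part P)).
Proof.
apply: prod_XsubC_eq; rewrite big_cons -!eigenvaluesP.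
rewrite -!(map_char_poly (real_complex R)) char_poly_diff_part rmorphM/=.
by rewrite map_polyXsubC/= rmorph1.
Qed.

End Blocks.
End Differences.

(** * Consensus certificates from spectral conditions *)

Section Certificate.
Context {R : realType}.
Local Notation C := R[i].
Local Notation Re := (@complex.Re R).
Local Notation Im := (@complex.Im R).
Local Notation ones n := (const_mx 1 : 'cV[R]_n).

(* [x |-> sqn (L *m x)] is a strict Lyapunov function of [y' = (P - 1) y] in the
   directions transverse to consensus, and [p *m x] is a conserved quantity. *)
Definition consensus_certificate n (P : 'M[R]_n) := exists m
  (L : 'M[R]_(m, n)) (p : 'rV[R]_n) (N : 'M[R]_(n, m)) (c : R),
  [/\ 0 < c,
      forall x, dot (L *m x) (L *m ((P - 1%:M) *m x)) <= - c * sqn (L *m x),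
      p *m (P - 1%:M) = 0 &
      forall x : 'cV[R]_n, x - ones n *m (p *m x) = N *m (L *m x)].

(** With [p = 0] the last clause of the certificate says that [N] is a left inverse of [L], so the
    state itself is driven to 0. *)
Lemma certificate_of_stable n (P : 'M[R]_n) :
  (forall z, z \in eigenvalues P -> Re z < 1) -> consensus_certificate P.
Proof.
case/lyapunov_form => L [L' [c [c0 L'L hL]]].
exists (n + n)%N, L, 0, L', c; split => //; first by rewrite mul0mx.
by move=> x; rewrite (mulmxA L') L'L mul1mx mul0mx mulmx0 subr0.
Qed.

Lemma stable_sub1_unit n (P : 'M[R]_n) :
  (forall z, z \in eigenvalues P -> Re z < 1) -> P - 1%:M \in unitmx.
Proof.
move=> hP; rewrite -row_free_unit -kermx_eq0; apply/negPn/negP => h.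
have : eigenvalue P 1 by [].
rewrite eigenvalue_root_char => h1.
have /hP : (1 : C) \in eigenvalues P.
  rewrite mem_eigenvalues -map_char_poly -(rmorph1 (real_complex R)).
  by rewrite fmorph_root.
by rewrite /= ltxx.
Qed.

(** The Lyapunov form of [diff_part P] is pulled back along [diff_mx m]. The row [p] is a left
    eigenvector of [P] for 1, normalized to have sum 1. *)
Lemma certificate_of_diff_stable m (P : 'M[R]_(1 + m)) :
  P *m ones (1 + m) = ones (1 + m) ->
  (forall z, z \in eigenvalues (diff_part P) -> Re z < 1) -> consensus_certificate P.
Proof.
move=> P1 hP; have [L [L' [c [c0 L'L hL]]]] := lyapunov_form hP.
have Qu := stable_sub1_unit hP; set Q := diff_part P - 1%:M in Qu hL.
have DQ : diff_mx m *m (P - 1%:M) = Q *m diff_mx m.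
  by rewrite mulmxBr mulmx1 diff_mx_mul// /Q (mulmxBl (diff_part P)) mul1mx.
pose e0 : 'rV[R]_(1 + m) := row_mx 1%:M 0.
have e0Q : e0 *m (P - 1%:M) = ursubmx P *m diff_mx m.
  have hu : ulsubmx P - 1%:M = - (ursubmx P *m ones m).
    by rewrite (ulsubmx_row_sums P1) addrC addKr.
  rewrite mulmxBr mulmx1 -{1}[P]submxK mul_row_block !mul1mx !mul0mx.
  rewrite opp_row_mx add_row_mx subr0 !addr0 hu.
  by rewrite /diff_mx mul_mx_row mulmx1 mulmxN.
(* [e0] reads [x_0], whose drift depends on the differences only; the correction cancels this drift
   because [Q] is invertible and governs the differences. *)
pose p := e0 - ursubmx P *m invmx Q *m diff_mx m.
(* Subtracting [x_0] from every entry leaves [col_mx 0] of the differences; the second summand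
   accounts for the correction in [p]. *)
have px (x : 'cV[R]_(1 + m)) : x - ones (1 + m) *m (p *m x) =
   (col_mx 0 1%:M + ones (1 + m) *m (ursubmx P *m invmx Q)) *m (diff_mx m *m x).
  rewrite mulmxBl mulmxBr mulmxDl opprB addrCA addrC -!mulmxA; congr (_ + _).
  rewrite -[x]vsubmxK /e0 /diff_mx !mul_row_col !mul1mx !mul0mx addr0.
  have -> : ones (1 + m) = col_mx (ones 1) (ones m) by rewrite col_mx_const.
  rewrite !mul_col_mx opp_col_mx add_col_mx mul0mx mul1mx; congr col_mx.
    apply/matrixP => i j; rewrite !mxE big_ord1 !mxE mul1r !ord1.
    by rewrite subrr.
  by rewrite mulNmx addrC.
exists (m + m)%N, (L *m diff_mx m), p,
  ((col_mx 0 1%:M + ones (1 + m) *m (ursubmx P *m invmx Q)) *m L'), c; split => //.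
- move=> x; rewrite -!(mulmxA L).
  by rewrite (mulmxA (diff_mx m)) DQ -mulmxA; exact: hL.
- by rewrite mulmxBl e0Q -!mulmxA DQ (mulmxA (invmx Q)) mulVmx// mul1mx subrr.
- move=> x; rewrite px -!mulmxA; congr (_ *m _).
  by rewrite !mulmxA L'L mul1mx.
Qed.

(** * The flow of the mean along real eigenplanes *)

Fixpoint mean_flow (a : nat -> R) n (A : 'M[R]_n) s : 'M[R]_n :=
  if s is s'.+1 then mean_flow a A s' + a s' *: ((A - 1%:M) *m mean_flow a A s')
  else 1%:M.

(** The flow is a polynomial in [A]. Commuting lets [A - 1%:M] act first, directly on an
    eigenvector. *)
Lemma mean_flow_comm a n (A : 'M[R]_n) s :
  (A - 1%:M) *m mean_flow a A s = mean_flow a A s *m (A - 1%:M).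
Proof.
elim: s => [|s ih] /=; first by rewrite mulmx1 mul1mx.
by rewrite (mulmxDr (A - _)) (mulmxDl (mean_flow a A s)) -scalemxAr -scalemxAl -mulmxA -!ih.
Qed.

Lemma mean_flow_mulS a n (A : 'M[R]_n) s p (v : 'M[R]_(n, p)) :
  mean_flow a A s.+1 *m v =
  mean_flow a A s *m v + a s *: (mean_flow a A s *m ((A - 1%:M) *m v)).
Proof. by rewrite /= mean_flow_comm (mulmxDl (mean_flow a A s)) -scalemxAl -mulmxA. Qed.

(** The complex number [f + i g] is multiplied at each step by [1 + a s (al + i be)], whose modulus
    is at least 1, so its modulus can tend to 0 only if it starts at 0. *)
Lemma spiral_sqr_ndecr (a : nat -> R) (f g : nat -> R) (al be : R) :
  (forall s, 0 <= a s) -> 0 <= al ->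
  (forall s, f s.+1 = f s + a s * (al * f s - be * g s)) ->
  (forall s, g s.+1 = g s + a s * (be * f s + al * g s)) ->
  f @ \oo --> 0 -> g @ \oo --> 0 -> f 0%N = 0 /\ g 0%N = 0.
Proof.
move=> a0 al0 hf hg f0 g0.
pose q s := f s * f s + g s * g s.
have qnd : {homo q : m n / (m <= n)%N >-> m <= n}.
  apply/nondecreasing_seqP => s; rewrite /q hf hg.
  move: (f s) (g s) (a s) (a0 s) => x y t t0.
  rewrite -subr_ge0 (_ : _ - _ = (x * x + y * y) *
    (2 * (t * al) + (t * al) * (t * al) + (t * be) * (t * be))); last by ring.
  apply: mulr_ge0; first by rewrite addr_ge0// -expr2 sqr_ge0.
  rewrite addr_ge0// -?expr2 ?sqr_ge0// addr_ge0// ?sqr_ge0//.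
  by rewrite !mulr_ge0.
have qc : q @ \oo --> 0.
  rewrite -[X in _ --> X](_ : 0 * 0 + 0 * 0 = 0 :> R); last by rewrite !mulr0 addr0.
  by apply: cvgD; apply: cvgM.
have : q 0%N <= 0.
  have <- : limn q = 0 by exact: cvg_lim.
  by apply: nondecreasing_cvgn_le => //; apply/cvg_ex; exists 0.
rewrite /q -!expr2 => h.
have := sqr_ge0 (f 0%N); have := sqr_ge0 (g 0%N) => h1 h2.
by split; apply/eqP; rewrite -sqrf_eq0 eq_le; apply/andP; split; lra.
Qed.

(** Along the flow, the values of [phi] on [v] and [w] form the spiral of [spiral_sqr_ndecr] with
    [al = Re z - 1] and [be = Im z]. *)
Lemma eigenvector_killed (a : nat -> R) n (A : 'M[R]_n) z (v w : 'cV[R]_n)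
    (phi : 'rV[R]_n) :
  (forall s, 0 <= a s) -> 1 <= Re z ->
  A *m v = Re z *: v - Im z *: w -> A *m w = Im z *: v + Re z *: w ->
  (forall u : 'cV[R]_n, (phi *m (mean_flow a A s *m u)) 0 0 @[s --> \oo] --> 0) ->
  (phi *m v) 0 0 = 0 /\ (phi *m w) 0 0 = 0.
Proof.
move=> a0 z1 Av Aw hphi.
have := @spiral_sqr_ndecr a (fun s => (phi *m (mean_flow a A s *m v)) 0 0)
  (fun s => (phi *m (mean_flow a A s *m w)) 0 0) (Re z - 1) (Im z) a0.
rewrite /= !mul1mx; apply => //; first by rewrite subr_ge0.
- move=> s; rewrite (mean_flow_mulS a A s v) mulmxBl mul1mx Av.
  rewrite !(mulmxDr, mulmxN, mulmxDl, =^~ scalemxAr); rewrite !mxE.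
  by ring.
- move=> s; rewrite (mean_flow_mulS a A s w) mulmxBl mul1mx Aw.
  rewrite !(mulmxDr, mulmxN, mulmxDl, =^~ scalemxAr); rewrite !mxE.
  by ring.
Qed.

End Certificate.

(** * Spectral conditions forced by consensus of the mean *)

Section Necessity.
Context {R : realType}.
Local Notation C := R[i].
Local Notation Re := (@complex.Re R).
Local Notation Im := (@complex.Im R).
Local Notation ones n := (const_mx 1 : 'cV[R]_n).

(** The eigenvalue 1 carried by the constants is not counted, so the count is [m] exactly when all
    [m] eigenvalues of [diff_part P] are. *)
Lemma count_diff m (P : 'M[R]_(1 + m)) : P *m ones (1 + m) = ones (1 + m) ->
  count (fun z => Re z < 1) (eigenvalues P) = m <->
  forall z, z \in eigenvalues (diff_part P) -> Re z < 1.
Proof.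
move=> P1; rewrite (permP (perm_eigenvalues_diff P1)) /= ltxx add0n.
rewrite -[X in _ = X](size_eigenvalues (diff_part P)).
split=> [/eqP|h]; first by rewrite -all_count => /allP.
by apply/eqP; rewrite -all_count; apply/allP.
Qed.

Lemma certificate_of_spectrum m (P : 'M[R]_(1 + m)) :
  rho_max P < 1 \/ ((forall i, \sum_(j < 1 + m) P i j = 1) /\
    count (fun z => Re z < 1) (eigenvalues P) = m) ->
  consensus_certificate P.
Proof.
case=> [/rho_max_lt1|[/row_sums P1 /(count_diff P1)]].
  by move=> /(_ isT); exact: certificate_of_stable.
exact: certificate_of_diff_stable.
Qed.

Lemma mean_flow_diff a m (P : 'M[R]_(1 + m)) s : P *m ones (1 + m) = ones (1 + m) ->
  mean_flow a (diff_part P) s *m diff_mx m = diff_mx m *m mean_flow a P s.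
Proof.
move=> P1; elim: s => [|s ih]; first by rewrite /= mulmx1 mul1mx.
have DQ : diff_mx m *m (P - 1%:M) = (diff_part P - 1%:M) *m diff_mx m.
  by rewrite mulmxBr mulmx1 diff_mx_mul// (mulmxBl (diff_part P)) mul1mx.
rewrite /= (mulmxDl (mean_flow a _ s)) (mulmxDr (diff_mx m)) ih.
by rewrite -scalemxAl -scalemxAr -mulmxA ih !mulmxA DQ.
Qed.

Lemma diff_mxE m (y : 'cV[R]_(1 + m)) i :
  (diff_mx m *m y) i 0 = y (rshift 1 i) 0 - y (lshift m 0) 0.
Proof.
rewrite -[y in LHS]vsubmxK /diff_mx mul_row_col mul1mx mulNmx !mxE addrC.
by rewrite big_ord1 !mxE mul1r.
Qed.

(** If i) fails, an eigenvalue with real part at least 1 has constant eigenvectors, so all row sums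
    of [P] equal that real part. Boundedness of the flow forces it to be 1, and the dynamics of the
    differences settles the other eigenvalues. *)
Lemma spectrum_of_mean_consensus (a : nat -> R) m (P : 'M[R]_(1 + m)) :
  (forall s, 0 <= a s) -> series a n @[n --> \oo] --> +oo ->
  (forall (u : 'cV[R]_(1 + m)) i, exists B,
     \forall s \near \oo, (mean_flow a P s *m u) i 0 <= B) ->
  (forall (u : 'cV[R]_(1 + m)) i j,
     (mean_flow a P s *m u) i 0 - (mean_flow a P s *m u) j 0 @[s --> \oo] --> 0) ->
  rho_max P < 1 \/ ((forall i, \sum_(j < 1 + m) P i j = 1) /\
    count (fun z => Re z < 1) (eigenvalues P) = m).
Proof.
move=> a0 ay hbd hcv.
have [rho1|/negP rho1] := boolP (rho_max P < 1); [by left|right].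
have [z [hz z1]] : exists z, z \in eigenvalues P /\ 1 <= Re z.
  apply: contrapT => h; apply: rho1; apply/rho_max_lt1 => // z hz.
  by rewrite ltNge; apply/negP => z1; apply: h; exists z.
have [v [w [vw Av Aw]]] := eigenvector_pair hz.
have vwc i : v i 0 = v 0 0 /\ w i 0 = w 0 0.
  pose phi : 'rV[R]_(1 + m) := delta_mx 0 i - delta_mx 0 0.
  have phiE u : (phi *m u) 0 0 = u i 0 - u 0 0.
    by rewrite /phi mulmxBl -!rowE !mxE.
  have [|] := eigenvector_killed (phi := phi) a0 z1 Av Aw.
    by move=> u; under eq_fun do rewrite phiE; exact: hcv.
  by rewrite !phiE => /eqP; rewrite subr_eq0 => /eqP -> /eqP; rewrite subr_eq0 => /eqP ->.
have vE : v = v 0 0 *: ones _.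
  by apply/matrixP => i j; rewrite !mxE !ord1 mulr1; have [] := vwc i.
have wE : w = w 0 0 *: ones _.
  by apply/matrixP => i j; rewrite !mxE !ord1 mulr1; have [] := vwc i.
have vw0 : v 0 0 * v 0 0 + w 0 0 * w 0 0 != 0.
  apply: contraL vw; rewrite paddr_eq0 -?expr2 ?sqr_ge0// !sqrf_eq0.
  case/andP => /eqP v0 /eqP w0; rewrite vE wE v0 w0 !scale0r.
  by rewrite eqxx.
(* With [v] and [w] equal to [p] and [q] times the constant vector, [p] times the first
   eigenequation plus [q] times the second eliminates [Im z]. *)
have P1 : P *m ones _ = Re z *: ones _.
  move: Av Aw; rewrite vE wE; move: (v 0 0) (w 0 0) vw0 => p q pq.
  rewrite -!scalemxAr => Av Aw; apply/matrixP => i j.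
  move/matrixP/(_ i j): Av; move/matrixP/(_ i j): Aw; rewrite !mxE.
  set t := \sum_(k < _) _; rewrite !mulr1 => h1 h2.
  apply: (mulfI pq); rewrite mulrDl -!mulrA h1 h2.
  by ring.
pose al := Re z - 1.
have al0 : 0 <= al by rewrite subr_ge0.
have Q1 : (P - 1%:M) *m ones _ = al *: ones _.
  by rewrite mulmxBl mul1mx P1 scalerBl scale1r.
(* Bernoulli's inequality for the product of the factors [1 + al * a k]. *)
have flow1 s : exists2 c, mean_flow a P s *m ones _ = c *: ones _ &
    1 + al * series a s <= c.
  elim: s => [|s [c hc cl]].
    by exists 1; rewrite /= ?mul1mx ?scale1r// seriesEnat/= big_geq// mulr0 addr0.
  exists (c + a s * (al * c)).
    by rewrite mean_flow_mulS Q1 -scalemxAr hc !scalerA -scalerDl mulrA.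
  have c1 : 1 <= c.
    apply: le_trans cl; rewrite lerDl mulr_ge0// seriesEnat/=.
    by rewrite sumr_ge0.
  rewrite seriesSr mulrDr addrA lerD// [leRHS]mulrCA ler_wpM2l//.
  by rewrite ler_peMr.
(* A positive [al] would make the flow of the constants unbounded, since [series a] diverges. *)
have al00 : al = 0.
  apply/eqP; rewrite eq_le al0 andbT leNgt; apply/negP => alp.
  have [B [N1 _ hB]] := hbd (ones _) 0.
  move/cvgryPgt : ay => /(_ (B / al)) [N2 _ hN2].
  have /= := hN2 (N1 + N2)%N (leq_addl _ _); have := hB (N1 + N2)%N (leq_addr _ _).
  have [c -> hc] := flow1 (N1 + N2)%N; rewrite /= !mxE mulr1 => cB.
  by rewrite ltr_pdivrMr// => h; lra.
have z11 : Re z = 1 by apply/eqP; rewrite -subr_eq0 -/al al00.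
have {}P1 : P *m ones _ = ones _ by rewrite P1 z11 scale1r.
split; first exact/row_sums.
apply/(count_diff P1) => y hy; rewrite ltNge; apply/negP => y1.
have [v1 [w1 [vw1 Av1 Aw1]]] := eigenvector_pair hy.
have {}vw1c i : v1 i 0 = 0 /\ w1 i 0 = 0.
  pose phi : 'rV[R]_m := delta_mx 0 i.
  have phiE u : (phi *m u) 0 0 = u i 0 by rewrite /phi -rowE mxE.
  have [|] := eigenvector_killed (phi := phi) a0 y1 Av1 Aw1.
    (* Every vector of differences comes from a state, so consensus from all initial states sends
       the flow of the differences to 0. *)
    move=> u; have -> : u = diff_mx m *m col_mx 0 u.
      by rewrite /diff_mx mul_row_col mulmx0 mul1mx add0r.
    under eq_fun do rewrite phiE mulmxA mean_flow_diff// -mulmxA diff_mxE.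
    exact: hcv.
  by rewrite !phiE.
have v10 : v1 = 0 by apply/matrixP => i j; rewrite !mxE !ord1; have [] := vw1c i.
have w10 : w1 = 0 by apply/matrixP => i j; rewrite !mxE !ord1; have [] := vw1c i.
by move: vw1; rewrite v10 w10 eqxx.
Qed.

End Necessity.
(** * Conditional expectations *)

Section SubSigmaAlgebra.
Context {d : measure_display} {T : measurableType d} {R : realType}.
Variable Pr : probability T R.
Variable U : set (set T).
Hypothesis mU : <<s U >> `<=` measurable.
Local Notation TU := (g_sigma_algebraType U).

Import HBNNSimple.

Lemma sub_sigma_measurable_fun (Y : T -> R) :
  measurable_fun setT (Y : TU -> R) -> measurable_fun setT Y.
Proof. by move=> mY _ B mB; apply: mU; apply: mY. Qed.

(** Splits the integral over the level sets of [h], which lie in [<<s U >>], where integrals of [X]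
    can be compared. *)
Lemma integral_mul_simple (X : T -> R) (h : {nnsfun TU >-> R}) :
  measurable_fun setT X -> (forall w, 0 <= X w) ->
  (\int[Pr]_w (X w * h w)%:E =
   \sum_(y \in range h) y%:E * \int[Pr]_(w in h @^-1` [set y]) (X w)%:E)%E.
Proof.
move=> mX X0.
pose A r : set T := h @^-1` [set r].
have mA r : measurable (A r).
  by apply: mU; rewrite -[X in <<s U >> X]setTI; exact: (measurable_funP h).
transitivity (\int[Pr]_w (\sum_(y \in range h) (X w * (y * \1_(A y) w))%:E))%E.
  apply: eq_integral => w _; rewrite [in LHS](fimfunE h) fsumEFin//.
  by rewrite !fsbig_finite// ?mulr_sumr.
have mi r : measurable_fun [set: T] (fun w => X w * (r * \1_(A r) w)).
  by apply: measurable_funM => //; apply: measurable_funM => //; exact: measurable_indic.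
rewrite ge0_integral_fsum//; last 2 first.
- by move=> r; exact/measurable_EFinP.
- move=> y w _; rewrite lee_fin mulr_ge0//.
  rewrite /indic; have [|] := boolP (w \in _); last by rewrite mulr0.
  by rewrite inE /A /= => <-; rewrite mulr1.
apply: eq_fsbigr => y; rewrite inE => -[w0 _ <-].
rewrite -/(A (h w0)) (integral_mkcond (A _)) -ge0_integralZl ?lee_fin//.
- apply: eq_integral => w _; rewrite patchE /indic.
  by case: ifPn => ?; rewrite ?mulr1 ?mulr0 ?mule0 ?EFinM// muleC.
- by apply/measurable_restrict => //; exact/measurable_funTS/measurable_EFinP.
- by move=> w _; rewrite patchE; case: ifP => // _; rewrite lee_fin.
Qed.

Lemma cvg_integral_mul_approx (X Y : T -> R) (mY : measurable_fun setT (EFin \o Y : TU -> \bar R)) :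
  measurable_fun setT X -> (forall w, 0 <= X w) -> (forall w, 0 <= Y w) ->
  (\int[Pr]_w (X w * nnsfun_approx measurableT mY n w)%:E @[n --> \oo] -->
   \int[Pr]_w (X w * Y w)%:E)%E.
Proof.
move=> mX X0 Y0; set h := nnsfun_approx _ _.
have h_cvg w : EFin \o h^~ w @ \oo --> (Y w)%:E.
  by apply: cvg_nnsfun_approx => // v _; rewrite lee_fin.
have -> : (\int[Pr]_w (X w * Y w)%:E =
    \int[Pr]_w lim ((X w * h n w)%:E @[n --> \oo]))%E.
  apply: eq_integral => w _; apply/esym/cvg_lim => //.
  by under eq_fun do rewrite EFinM; rewrite EFinM; apply: cvgeZl => //; exact: h_cvg.
apply: cvg_monotone_convergence => //.
- move=> n; apply/measurable_EFinP; apply: measurable_funM => //.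
  apply: sub_sigma_measurable_fun; exact/measurable_funP.
- by move=> n w _; rewrite lee_fin mulr_ge0.
- move=> w _ i j ij; rewrite lee_fin ler_wpM2l//.
  by have /lefP := nd_nnsfun_approx (measurableT : measurable [set: TU]) mY ij; apply.
Qed.

(** The inequality on sets of [<<s U >>] extends to simple functions by level sets, then to [Y] by
    monotone convergence. *)
Lemma le_integral_mul (X1 X2 Y : T -> R) :
  measurable_fun setT X1 -> (forall w, 0 <= X1 w) ->
  measurable_fun setT X2 -> (forall w, 0 <= X2 w) ->
  measurable_fun setT (Y : TU -> R) -> (forall w, 0 <= Y w) ->
  (forall A, <<s U >> A ->
     (\int[Pr]_(w in A) (X1 w)%:E <= \int[Pr]_(w in A) (X2 w)%:E)%E) ->
  (\int[Pr]_w (X1 w * Y w)%:E <= \int[Pr]_w (X2 w * Y w)%:E)%E.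
Proof.
move=> mX1 X10 mX2 X20 mY Y0 hX.
have mY' : measurable_fun setT (EFin \o Y : TU -> \bar R) by exact/measurable_EFinP.
have c1 := cvg_integral_mul_approx mY' mX1 X10 Y0.
have c2 := cvg_integral_mul_approx mY' mX2 X20 Y0.
rewrite -(cvg_lim _ c1)// -(cvg_lim _ c2)//.
apply: lee_lim; [by apply/cvg_ex; eexists; exact: c1|by apply/cvg_ex; eexists; exact: c2|].
apply: nearW => n; rewrite !integral_mul_simple//.
rewrite !fsbig_finite//=; apply: lee_sum => y _.
have [y0|y0] := leP 0 y.
  apply: lee_wpmul2l; first by rewrite lee_fin.
  have mh : measurable_fun [set: TU] (nnsfun_approx measurableT mY' n : TU -> R).
    exact/measurable_funP.
  by apply: hX; have := mh measurableT _ (measurable_set1 y); rewrite setTI; apply.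
(* A nonnegative simple function does not take the negative value [y]. *)
rewrite (_ : _ @^-1` _ = set0); first by rewrite !integral_set0.
apply/seteqP; split => // w /= hw; exfalso; move: y0; rewrite -hw.
by rewrite ltNge => /negP; apply.
Qed.

End SubSigmaAlgebra.

(** * Integrable and square-integrable real random variables *)

Section RealExpectation.
Context {d : measure_display} {T : measurableType d} {R : realType}.
Variable Pr : probability T R.
Implicit Types f g : T -> R.

Definition L1 f := Pr.-integrable [set: T] (EFin \o f).
Definition E f : R := (\int[Pr]_w f w)%R.

Lemma L1_measurable f : L1 f -> measurable_fun [set: T] f.
Proof. by move=> /measurable_int /measurable_EFinP. Qed.

Lemma L1_cst c : L1 (cst c).
Proof. exact: finite_measure_integrable_cst. Qed.

Lemma L1D f g : L1 f -> L1 g -> L1 (fun w => f w + g w).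
Proof. by move=> hf hg; exact: (integrableD measurableT hf hg). Qed.

Lemma L1Z c f : L1 f -> L1 (fun w => c * f w).
Proof. by move=> hf; exact: (integrableZl measurableT c hf). Qed.

Lemma L1_sum n (F : 'I_n -> T -> R) : (forall i, L1 (F i)) ->
  L1 (fun w => \sum_i F i w).
Proof.
move=> hF; rewrite /L1 (_ : _ \o _ = fun w => (\sum_i (F i w)%:E)%E).
  by apply: (integrable_sum measurableT) => i _; exact: hF.
by apply/funext => w /=; rewrite sumEFin.
Qed.

Lemma L1_le f g : measurable_fun [set: T] f -> L1 g -> (forall w, `|f w| <= g w) -> L1 f.
Proof.
move=> mf hg fg; apply: le_integrable hg => //; first exact/measurable_EFinP.
by move=> w _ /=; rewrite lee_fin (le_trans (fg w))// ler_norm.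
Qed.

Lemma L1_norm f : L1 f -> L1 (fun w => `|f w|).
Proof. exact: integrable_norm. Qed.

Lemma ED f g : L1 f -> L1 g -> E (fun w => f w + g w) = E f + E g.
Proof. by move=> hf hg; rewrite /E RintegralD. Qed.

Lemma EZ c f : L1 f -> E (fun w => c * f w) = c * E f.
Proof. by move=> hf; rewrite /E RintegralZl. Qed.

Lemma E_cst c : E (cst c) = c.
Proof. by rewrite /E Rintegral_cst// [X in fine X](probability_setT Pr) mulr1. Qed.

Lemma eq_E f g : f =1 g -> E f = E g.
Proof. by move=> /funext ->. Qed.

Lemma E_sum n (F : 'I_n -> T -> R) : (forall i, L1 (F i)) ->
  E (fun w => \sum_i F i w) = \sum_i E (F i).
Proof.
elim: n F => [|n ih] F hF.
  rewrite big_ord0 (@eq_E _ (cst 0)) ?E_cst// => w.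
  by rewrite big_ord0.
rewrite (@eq_E _ (fun w => F ord0 w + \sum_(i < n) F (lift ord0 i) w)); last first.
  by move=> w; rewrite big_ord_recl.
by rewrite ED ?ih ?big_ord_recl//; exact: L1_sum.
Qed.

Lemma E_le f g : L1 f -> L1 g -> (forall w, f w <= g w) -> E f <= E g.
Proof. by move=> hf hg fg; apply: le_Rintegral. Qed.

Lemma E_ge0 f : (forall w, 0 <= f w) -> 0 <= E f.
Proof. by move=> f0; apply: Rintegral_ge0. Qed.

Lemma EFin_E f : L1 f -> (\int[Pr]_w (f w)%:E)%E = (E f)%:E.
Proof. by move=> hf; rewrite /E /Rintegral fineK//; exact: integrable_fin_num. Qed.

Lemma L1_ge0 f : measurable_fun [set: T] f -> (forall w, 0 <= f w) ->
  (\int[Pr]_w (f w)%:E < +oo)%E -> L1 f.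
Proof.
move=> mf f0 hf; apply/integrableP; split; first exact/measurable_EFinP.
by under eq_integral do rewrite /= ger0_norm//.
Qed.

Definition L2 f := measurable_fun [set: T] f /\ L1 (fun w => f w ^+ 2).

Lemma L2_mul f g : L2 f -> L2 g -> L1 (fun w => f w * g w).
Proof.
move=> [mf hf] [mg hg]; apply: (L1_le _ (L1D hf hg)); first exact: measurable_funM.
move=> w; rewrite normrM -[f w ^+ 2]real_normK ?num_real// -[g w ^+ 2]real_normK ?num_real//.
move: `|f w| `|g w| (normr_ge0 (f w)) (normr_ge0 (g w)) => x y x0 y0.
by have := sqr_ge0 (x - y); have := mulr_ge0 x0 y0; rewrite !expr2; lra.
Qed.

Lemma L2D f g : L2 f -> L2 g -> L2 (fun w => f w + g w).
Proof.
move=> [mf hf] [mg hg]; split; first exact: measurable_funD.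
apply: (L1_le _ (L1D (L1Z 2 hf) (L1Z 2 hg))).
  by apply: measurable_funX; exact: measurable_funD.
move=> w; rewrite ger0_norm ?sqr_ge0//.
by have := sqr_ge0 (f w - g w); rewrite !expr2; lra.
Qed.

Lemma L2Z c f : L2 f -> L2 (fun w => c * f w).
Proof.
move=> [mf hf]; split; first by apply: measurable_funM.
by under [X in L1 X]eq_fun do rewrite exprMn; exact: L1Z.
Qed.

Lemma L2_cst c : L2 (cst c).
Proof. by split => //; exact: (L1_cst (c ^+ 2)). Qed.

Lemma L2_sum n (F : 'I_n -> T -> R) : (forall i, L2 (F i)) ->
  L2 (fun w => \sum_i F i w).
Proof.
elim: n F => [|n ih] F hF.
  by under [X in L2 X]eq_fun do rewrite big_ord0; exact: L2_cst.
under [X in L2 X]eq_fun do rewrite big_ord_recl.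
by apply: L2D => //; exact: ih.
Qed.

Lemma L2_L1 f : L2 f -> L1 f.
Proof.
move=> hf; have := L2_mul hf (L2_cst 1).
by under [X in L1 X]eq_fun do rewrite mulr1.
Qed.

End RealExpectation.

(** * Multiplying by factors measurable for the conditioning *)

Section ConditionalExpectation.
Context {d : measure_display} {T : measurableType d} {R : realType}.
Variable Pr : probability T R.
Variable U : set (set T).
Hypothesis mU : <<s U >> `<=` measurable.
Local Notation TU := (g_sigma_algebraType U).
Local Notation L1 := (L1 Pr).
Local Notation E := (E Pr).

(** Over each set of [<<s U >>] the integral of [X] is at most that of [C], so [le_integral_mul]
    applies. Integrability of the product follows from the finite bound. *)
Lemma cond_exp_mul_le (X Y Z : T -> R) (C : R) :
  is_cond_exp Pr <<s U >> X Z -> {ae Pr, forall w, Z w <= C} -> 0 <= C ->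
  (forall w, 0 <= X w) ->
  measurable_fun setT (Y : TU -> R) -> (forall w, 0 <= Y w) -> L1 Y ->
  L1 (fun w => X w * Y w) /\ E (fun w => X w * Y w) <= C * E Y.
Proof.
move=> [iX iZ _ hZ] ZC C0 X0 mY Y0 iY.
have mX := L1_measurable iX.
have hle : (\int[Pr]_w (X w * Y w)%:E <= \int[Pr]_w (C * Y w)%:E)%E.
  apply: (le_integral_mul mU (X2 := cst C)) => // A GA.
  have mA := mU GA.
  have iZA : Pr.-integrable A (EFin \o Z) by exact: integrableS iZ.
  rewrite -hZ//.
  (* The bound on [Z] holds almost everywhere only; the truncation agrees with [Z] there and is at
     most [C] everywhere. *)
  have iM : Pr.-integrable A (EFin \o (fun w => Num.min (Z w) C)).
    apply: (@le_integrable _ _ _ _ _ mA _ (EFin \o (fun w => `|Z w| + C))).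
    - apply/measurable_EFinP; apply: measurable_minr => //.
      by apply/measurable_EFinP; exact: measurable_int iZA.
    - move=> w _ /=; rewrite lee_fin [leRHS]ger0_norm ?addr_ge0//.
      by case: (leP (Z w) C) => _; rewrite ?(ger0_norm C0) ?lerDl ?lerDr.
    - have h1 : Pr.-integrable A (EFin \o (fun w => `|Z w|)) by exact: integrable_norm.
      have h2 : Pr.-integrable A (EFin \o cst C) by exact: finite_measure_integrable_cst.
      exact: (integrableD mA h1 h2).
  rewrite (ae_eq_integral (EFin \o (fun w => Num.min (Z w) C)))//=.
  - apply: le_integral => //; first exact: finite_measure_integrable_cst.
    by move=> w _; rewrite lee_fin ge_min lexx orbT.
  - exact: measurable_int iZA.
  - exact: measurable_int iM.
  - by apply: filterS ZC => w ZC _ /=; rewrite min_l.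
have iCY := L1Z C iY.
have iXY : L1 (fun w => X w * Y w).
  apply: L1_ge0.
  - by apply: measurable_funM => //; exact: L1_measurable iY.
  - by move=> w; rewrite mulr_ge0.
  - by apply: (le_lt_trans hle); rewrite (EFin_E iCY) ltry.
split=> //; move: hle; rewrite (EFin_E iCY) (EFin_E iXY) lee_fin.
by rewrite EZ.
Qed.

Lemma cond_exp_pull_out_ge0 (X Y : T -> R) (c : R) :
  is_cond_exp Pr <<s U >> X (cst c) ->
  measurable_fun setT (Y : TU -> R) -> (forall w, 0 <= Y w) ->
  L1 Y -> L1 (fun w => X w * Y w) ->
  E (fun w => X w * Y w) = c * E Y.
Proof.
move=> [iX _ _ hX] mY Y0 iY iXY.
(* Adding [D] makes both [X] and its conditional mean [c] nonnegative. *)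
pose D := fun w => `|X w| + `|c|.
have iD : L1 D by apply: L1D; [exact: L1_norm|exact: L1_cst].
have eqA A : <<s U >> A ->
    (\int[Pr]_(w in A) (c + D w)%:E = \int[Pr]_(w in A) (X w + D w)%:E)%E.
  move=> GA; have mA := mU GA.
  have icA : Pr.-integrable A (EFin \o cst c) by exact: finite_measure_integrable_cst.
  have iDA : Pr.-integrable A (EFin \o D) by exact: integrableS iD.
  have iXA : Pr.-integrable A (EFin \o X) by exact: integrableS iX.
  have -> := integralD_EFin mA icA iDA.
  have -> := integralD_EFin mA iXA iDA.
  by rewrite hX.
have X0 w : 0 <= X w + D w by rewrite /D addrA addr_ge0// addrC -lerBlDr sub0r ler_normr lexx orbT.
have c0 w : 0 <= c + D w by rewrite /D addrCA addr_ge0// addrC -lerBlDr sub0r ler_normr lexx orbT.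
have iDY : L1 (fun w => D w * Y w).
  have -> : (fun w => D w * Y w) = (fun w => `|X w * Y w| + `|c| * Y w).
    by apply/funext => w; rewrite /D mulrDl normrM (ger0_norm (Y0 w)).
  by apply: L1D; [exact: L1_norm|exact: L1Z].
have mX := L1_measurable iX; have mD := L1_measurable iD.
have eqI : (\int[Pr]_w ((X w + D w) * Y w)%:E = \int[Pr]_w ((c + D w) * Y w)%:E)%E.
  apply/eqP; rewrite eq_le; apply/andP; split;
  apply: (le_integral_mul mU) => //; do ?[exact: measurable_funD].
  - by move=> A GA; rewrite eqA.
  - by move=> A GA; rewrite eqA.
have := congr1 fine eqI; rewrite -!/(Rintegral _ _ _).
under eq_Rintegral do rewrite mulrDl.
under [RHS]eq_Rintegral do rewrite mulrDl.
rewrite -![Rintegral _ _ _]/(E _) !ED//; last exact: L1Z.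
by move/addIr => ->; rewrite EZ.
Qed.

(** Writes [Y] as the difference of the nonnegative factors [Y + |Y|] and [|Y|]. *)
Lemma cond_exp_pull_out (X Y : T -> R) (c : R) :
  is_cond_exp Pr <<s U >> X (cst c) ->
  measurable_fun setT (Y : TU -> R) ->
  L1 Y -> L1 (fun w => X w * Y w) ->
  E (fun w => X w * Y w) = c * E Y.
Proof.
move=> hX mY iY iXY.
have iX : L1 X by case: hX.
have maY : measurable_fun setT ((fun w => `|Y w|) : TU -> R) by exact: measurableT_comp.
have iaY := L1_norm iY.
have iXaY : L1 (fun w => X w * `|Y w|).
  apply: L1_le (L1_norm iXY) _ => [|w]; last by rewrite !normrM normr_id.
  by apply: measurable_funM; [exact: L1_measurable iX|exact: L1_measurable iaY].
have h1 := cond_exp_pull_out_ge0 hX maY (fun=> normr_ge0 _) iaY iXaY.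
have iXs : L1 (fun w => X w * (Y w + `|Y w|)).
  by under [X in L1 X]eq_fun do rewrite mulrDr; exact: L1D.
have h2 : E (fun w => X w * (Y w + `|Y w|)) = c * E (fun w => Y w + `|Y w|).
  apply: cond_exp_pull_out_ge0 => //; last exact: L1D.
    exact: (measurable_funD (T := TU)).
  by move=> w; rewrite addrC -lerBlDr sub0r ler_normr lexx orbT.
move: h2; rewrite (eq_E _ (g := fun w => X w * Y w + X w * `|Y w|)); last first.
  by move=> w; rewrite mulrDr.
by rewrite !ED// h1 mulrDr => /addIr.
Qed.

End ConditionalExpectation.
(** * Completeness of L2 *)

Section L2Completeness.
Context {d : measure_display} {T : measurableType d} {R : realType}.
Variable Pr : probability T R.
Local Notation L1 := (L1 Pr).
Local Notation L2 := (L2 Pr).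
Local Notation E := (E Pr).

(** Nonnegativity of the variance of [|f|], with mean [m]. *)
Lemma sqr_E_norm_le (f : T -> R) : L2 f -> E (fun w => `|f w|) ^+ 2 <= E (fun w => f w ^+ 2).
Proof.
move=> hf; set m := E (fun w => `|f w|).
have iaf := L1_norm (L2_L1 hf).
have h : E (fun w => - m ^+ 2 + (2 * m) * `|f w|) <= E (fun w => f w ^+ 2).
  apply: E_le; [|exact: hf.2|].
    by apply: L1D; [exact: (L1_cst _ (- m ^+ 2))|exact: L1Z].
  move=> w; rewrite -[f w ^+ 2]real_normK ?num_real//.
  by have := sqr_ge0 (`|f w| - m); rewrite !expr2; lra.
move: h; rewrite ED ?EZ//; [|exact: (L1_cst _ (- m ^+ 2))|exact: L1Z].
rewrite (E_cst _ (- m ^+ 2)) -/m; apply: le_trans.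
by rewrite expr2; lra.
Qed.

(** The sum of the absolute increments has expectation at most 2, hence is almost everywhere finite,
    and the telescoping series converges absolutely. *)
Lemma ae_cvg_of_summable (f : nat -> T -> R) : (forall k, L1 (f k)) ->
  (forall k, E (fun w => `|f k.+1 w - f k w|) <= 2^-1 ^+ k) ->
  {ae Pr, forall w, cvgn (f ^~ w)}.
Proof.
move=> f1 hE; pose D k w := `|f k.+1 w - f k w|.
have D1 k : L1 (D k).
  apply: L1_norm; rewrite (_ : (fun w => _) = (fun w => f k.+1 w + -1 * f k w)).
    by apply: L1D => //; exact: L1Z.
  by apply/funext => w; rewrite mulN1r.
have D0 k w : 0 <= D k w by exact: normr_ge0.
pose g w := (\sum_(0 <= k <oo) (D k w)%:E)%E.
have g0 w : (0 <= g w)%E by apply: nneseries_ge0 => k _ _; rewrite lee_fin.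
have mD k : measurable_fun [set: T] (EFin \o D k).
  by apply/measurable_EFinP; exact: L1_measurable (D1 k).
have mg : measurable_fun [set: T] g.
  exact: (@ge0_emeasurable_sum _ _ _ [set: T] (fun k => EFin \o D k) xpredT
    (fun k w _ _ => D0 k w) (fun k _ => mD k)).
have ig : (\int[Pr]_w g w <= 2%:E)%E.
  rewrite integral_nneseries//; last by move=> k w _; rewrite lee_fin.
  apply: lime_le.
    by apply: is_cvg_nneseries => k _ _; apply: integral_ge0 => w _; rewrite lee_fin.
  apply: nearW => n.
  apply: (@le_trans _ _ (\sum_(0 <= k < n) (2^-1 ^+ k)%:E)%E).
    by apply: lee_sum => k _; rewrite (EFin_E (D1 k)) lee_fin; exact: hE.
  rewrite sumEFin lee_fin.
  have : \sum_(0 <= k < n) (2^-1 ^+ k : R) = 2 - 2 * 2^-1 ^+ n.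
    elim: n => [|n ih]; first by rewrite big_geq// expr0 mulr1 subrr.
    by rewrite big_nat_recr//= ih exprS mulrA divff// mul1r; lra.
  by move=> ->; rewrite gerBl mulr_ge0// exprn_ge0.
have /integrable_ae : Pr.-integrable [set: T] g.
  apply/integrableP; split => //.
  under eq_integral do rewrite gee0_abs//.
  by apply: le_lt_trans ig _; rewrite ltry.
move=> /(_ measurableT); apply: filterS => w /(_ I) gfin.
have h : cvgn (series (fun k => D k w)).
  apply: nondecreasing_is_cvgn.
    by apply/nondecreasing_seqP => k; rewrite seriesSr lerDl.
  exists (fine (g w)) => _ [k _ <-].
  rewrite -lee_fin fineK//= -sumEFin.
  by apply: nneseries_lim_ge => i _ _; rewrite lee_fin.
have : cvgn (series (telescope (f ^~ w))) by apply: normed_cvg; exact: h.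
rewrite telescopeK => h2.
rewrite (_ : f ^~ w = (fun k => f k w - f 0%N w) \+ cst (f 0%N w)).
  by apply: is_cvgD => //; exact: is_cvg_cst.
by apply/funext => k /=; rewrite subrK.
Qed.

Lemma L2_complete (M : nat -> T -> R) (b : nat -> R) : (forall s, L2 (M s)) ->
  (forall s t, (s <= t)%N -> E (fun w => (M t w - M s w) ^+ 2) <= b s) ->
  b @ \oo --> 0 ->
  exists2 Minf, L2 Minf & E (fun w => (M s w - Minf w) ^+ 2) @[s --> \oo] --> 0.
Proof.
move=> M2 hM hb.
have hsub (f g : T -> R) : L2 f -> L2 g -> L2 (fun w => f w - g w).
  move=> hf hg; have := L2D hf (L2Z (-1) hg).
  by under [X in L2 X]eq_fun do rewrite mulN1r.
(* Along the subsequence [n] the increments are summable in L1, so it converges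
   almost surely; Fatou's lemma then controls the distance to its limit. *)
have [N hN] : {N : nat -> nat & forall k s, (N k <= s)%N -> b s <= 4^-1 ^+ k}.
  apply: (@choice _ _ (fun k N => forall s, (N <= s)%N -> b s <= 4^-1 ^+ k)) => k.
  have e0 : 0 < 4^-1 ^+ k :> R by rewrite exprn_gt0.
  have [N _ hN] := cvgr_lt _ hb _ e0.
  by exists N => s Ns; apply: ltW; exact: hN.
pose n k := (\sum_(j < k.+1) (N j).+1)%N.
have nS k : n k.+1 = (n k + (N k.+1).+1)%N by rewrite /n big_ord_recr.
have nN k : (N k <= n k)%N by rewrite /n big_ord_recr/= (leq_trans (leqnSn _)) ?leq_addl.
have nk k : (k <= n k)%N.
  by elim: k => // k ih; rewrite nS addnS ltnS (leq_trans ih)// leq_addr.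
pose f k := M (n k).
have hE : forall k, E (fun w => `|f k.+1 w - f k w|) <= 2^-1 ^+ k.
  move=> k.
  have h1 := sqr_E_norm_le (hsub _ _ (M2 (n k.+1)) (M2 (n k))).
  have h2 : E (fun w => (M (n k.+1) w - M (n k) w) ^+ 2) <= 4^-1 ^+ k.
    by apply: le_trans (hM _ _ _) (hN _ _ (nN k)); rewrite nS leq_addr.
  rewrite -ler_sqr ?nnegrE ?exprn_ge0 ?E_ge0//.
  rewrite -exprM mulnC exprM (_ : 2^-1 ^+ 2 = 4^-1); first exact: le_trans h1 h2.
  by rewrite exprVn; congr (_^-1); rewrite -natrX.
have hae := ae_cvg_of_summable (fun k => L2_L1 (M2 (n k))) hE.
(* The upper limit is measurable on all of [T], including where the subsequence diverges. *)
pose Minf w := fine (limn_esup (fun k => (f k w)%:E)).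
have mMinf : measurable_fun [set: T] Minf.
  apply: measurableT_comp => //; apply: measurable_fun_limn_esup => k.
  by apply/measurable_EFinP; exact: (M2 _).1.
have hinf : {ae Pr, forall w, f k w @[k --> \oo] --> Minf w}.
  apply: filterS hae => w /cvg_ex[l hl].
  have hel : (f k w)%:E @[k --> \oo] --> l%:E by apply: cvg_EFin => //; exact: nearW.
  by rewrite /Minf is_cvg_limn_esupE ?(cvg_lim _ hel)//; apply/cvg_ex; exists l%:E.
have hbd s : (\int[Pr]_w ((M s w - Minf w) ^+ 2)%:E <= (b s)%:E)%E.
  have mf k : measurable_fun [set: T] (fun w => ((M s w - f k w) ^+ 2)%:E).
    apply/measurable_EFinP; apply: measurable_funX; apply: measurable_funB.
      exact: (M2 _).1.
    exact: (M2 _).1.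
  rewrite (ae_eq_integral (fun w => limn_einf (fun k => ((M s w - f k w) ^+ 2)%:E)))//.
  - apply: le_trans (fatou _ _ _ _) _ => //; first by move=> k w _; rewrite lee_fin sqr_ge0.
    rewrite limn_einf_lim; apply: lime_le; first exact: is_cvg_einfs.
    (* The index [i + s] ensures [s <= n (i + s)], as [hM] requires. *)
    apply: nearW => i; apply: (@le_trans _ _ (\int[Pr]_w ((M s w - f (i + s)%N w) ^+ 2)%:E)%E).
      by apply: ereal_inf_lbound; exists (i + s)%N => //=; rewrite leq_addr.
    have h := (hsub _ _ (M2 (n (i + s)%N)) (M2 s)).2.
    have -> : (fun w => ((M s w - f (i + s)%N w) ^+ 2)%:E) =
        (fun w => ((M (n (i + s)%N) w - M s w) ^+ 2)%:E).
      by apply/funext => w; rewrite -sqrrN opprB.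
    by rewrite EFin_E// lee_fin hM// (leq_trans (leq_addl i s)).
  - apply/measurable_EFinP; apply: measurable_funX; apply: measurable_funB => //.
    exact: (M2 _).1.
  - rewrite /limn_einf; apply: measurableT_comp => //.
    by apply: measurable_fun_limn_esup => k; apply: measurableT_comp => //; exact: mf.
  - apply: filterS hinf => w hw _; apply/esym.
    have hc : ((M s w - f k w) ^+ 2)%:E @[k --> \oo] --> ((M s w - Minf w) ^+ 2)%:E.
      apply: cvg_EFin; first exact: nearW.
      rewrite /comp/= expr2; under eq_fun do rewrite expr2.
      by apply: cvgM; apply: cvgB => //; exact: cvg_cst.
    by rewrite is_cvg_limn_einfE ?(cvg_lim _ hc)//; apply/cvg_ex; eexists; exact: hc.
have L2d s : L2 (fun w => M s w - Minf w).
  have m : measurable_fun [set: T] (fun w => M s w - Minf w).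
    by apply: measurable_funB => //; exact: (M2 _).1.
  split => //; apply: L1_ge0; first exact: measurable_funX.
    by move=> w; rewrite sqr_ge0.
  by apply: le_lt_trans (hbd s) _; rewrite ltry.
exists Minf.
  have := hsub _ _ (M2 0%N) (L2d 0%N).
  by under [X in L2 X]eq_fun do rewrite opprB addrC subrK.
apply: (squeeze_cvgr (f := cst 0) (h := b)) => //; last exact: cvg_cst.
apply: nearW => s /=; rewrite E_ge0 => [|w]; last by rewrite sqr_ge0.
by rewrite -lee_fin -(EFin_E (L2d s).2); exact: hbd.
Qed.

End L2Completeness.
(** * The stochastic system *)

Section RandomVectors.
Context {d : measure_display} {T : measurableType d} {R : realType}.
Variable Pr : probability T R.
Local Notation L1 := (L1 Pr).
Local Notation L2 := (L2 Pr).
Local Notation E := (E Pr).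

Definition vecL2 n (V : T -> 'cV[R]_n) := forall i, L2 (fun w => V w i 0).

Lemma vecL2D n (V W : T -> 'cV[R]_n) : vecL2 V -> vecL2 W -> vecL2 (fun w => V w + W w).
Proof.
by move=> hV hW i; under [X in L2 X]eq_fun do rewrite mxE; exact: L2D.
Qed.

Lemma vecL2Z n c (V : T -> 'cV[R]_n) : vecL2 V -> vecL2 (fun w => c *: V w).
Proof. by move=> hV i; under [X in L2 X]eq_fun do rewrite mxE; exact: L2Z. Qed.

Lemma vecL2_mulmx m n (A : 'M[R]_(m, n)) (V : T -> 'cV[R]_n) :
  vecL2 V -> vecL2 (fun w => A *m V w).
Proof.
move=> hV i; under [X in L2 X]eq_fun do rewrite mxE.
by apply: L2_sum => j; exact: L2Z.
Qed.

Lemma L1_dot n (V W : T -> 'cV[R]_n) : vecL2 V -> vecL2 W -> L1 (fun w => dot (V w) (W w)).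
Proof. by move=> hV hW; apply: L1_sum => i; exact: L2_mul. Qed.

Lemma L1_sqn n (V : T -> 'cV[R]_n) : vecL2 V -> L1 (fun w => sqn (V w)).
Proof. by move=> hV; exact: L1_dot. Qed.

Lemma E_sqn_ge0 n (V : T -> 'cV[R]_n) : 0 <= E (fun w => sqn (V w)).
Proof. by apply: E_ge0 => w; exact: sqn_ge0. Qed.

Lemma E_sqn_add n (V W : T -> 'cV[R]_n) c : vecL2 V -> vecL2 W ->
  E (fun w => sqn (V w + c *: W w)) =
  E (fun w => sqn (V w)) + 2 * c * E (fun w => dot (V w) (W w)) +
  c ^+ 2 * E (fun w => sqn (W w)).
Proof.
move=> hV hW.
have iV := L1_sqn hV; have iW := L1_sqn hW; have iVW := L1_dot hV hW.
rewrite -!EZ// -!ED//; do ?[by apply: L1Z|by apply: L1D => //; apply: L1Z].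
apply: eq_E => w; rewrite /sqn !dotDl !dotDr !dotZl !dotZr (dotC (W w) (V w)).
by ring.
Qed.

Lemma E_sqn_mulmx_le m n (A : 'M[R]_(m, n)) : exists2 K, 0 <= K &
  forall V : T -> 'cV[R]_n, vecL2 V ->
    E (fun w => sqn (A *m V w)) <= K * E (fun w => sqn (V w)).
Proof.
have [K K0 hK] := sqn_mulmx_le A; exists K => // V hV.
rewrite -EZ; last exact: L1_sqn.
by apply: E_le => //; [exact/L1_sqn/vecL2_mulmx|exact/L1Z/L1_sqn].
Qed.

Lemma dot_mulmx m n p (A : 'M[R]_(m, n)) (B : 'M[R]_(m, p)) x y :
  dot (A *m x) (B *m y) = \sum_k \sum_i (A^T *m B) k i * (x k 0 * y i 0).
Proof.
have dotE (u v : 'cV[R]_m) : dot u v = (u^T *m v) 0 0.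
  by rewrite mxE; apply: eq_bigr => i _; rewrite mxE.
rewrite dotE trmx_mul mulmxA -(mulmxA x^T) -mulmxA mxE.
apply: eq_bigr => k _; rewrite !mxE mulr_sumr; apply: eq_bigr => i _.
by rewrite mulrCA.
Qed.

(** Only the mixed moments of coordinates enter the expectation; this is how the drift is replaced
    by its conditional mean. *)
Lemma E_dot_mulmx m n p (A : 'M[R]_(m, n)) (B : 'M[R]_(m, p))
    (V : T -> 'cV[R]_n) (W W' : T -> 'cV[R]_p) : vecL2 V -> vecL2 W -> vecL2 W' ->
  (forall k i, E (fun w => V w k 0 * W w i 0) = E (fun w => V w k 0 * W' w i 0)) ->
  E (fun w => dot (A *m V w) (B *m W w)) = E (fun w => dot (A *m V w) (B *m W' w)).
Proof.
move=> hV hW hW' h.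
have EE W0 : vecL2 W0 -> E (fun w => dot (A *m V w) (B *m W0 w)) =
    \sum_k \sum_i (A^T *m B) k i * E (fun w => V w k 0 * W0 w i 0).
  move=> hW0; rewrite (eq_E _ (fun w => dot_mulmx A B (V w) (W0 w))).
  rewrite E_sum; last by move=> k; apply: L1_sum => i; exact/L1Z/L2_mul.
  apply: eq_bigr => k _; rewrite E_sum; last by move=> i; exact/L1Z/L2_mul.
  by apply: eq_bigr => i _; rewrite EZ//; exact: L2_mul.
by rewrite !EE//; apply: eq_bigr => k _; apply: eq_bigr => i _; rewrite h.
Qed.

(** Tests the supremum on the basis vector [e_j]; the supremum is usable once its set is known to be
    bounded. *)
Lemma mxnorm2_ge n (A : 'M[R]_n) i j : `|A i j| <= mxnorm2 A.
Proof.
pose B : set R := [set norm2 (A *m v) | v in [set v : 'cV[R]_n | norm2 v <= 1]].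
have [K K0 hK] := sqn_mulmx_le A.
have n0 (v : 'cV[R]_n) : 0 <= norm2 v by rewrite sqrtr_ge0.
have hB : has_ubound B.
  (* [1 + K] dominates the square root of [K]. *)
  exists (1 + K) => _ [v /= v1 <-].
  rewrite -ler_sqr ?nnegrE ?addr_ge0// norm2_sqr; apply: le_trans (hK v) _.
  have : sqn v <= 1 by rewrite -norm2_sqr expr_le1.
  by have := sqn_ge0 v; rewrite expr2; nra.
pose e : 'cV[R]_n := delta_mx j 0.
have e1 : norm2 e <= 1.
  rewrite -(@expr_le1 _ 2)// norm2_sqr sqnE (bigD1 j)//= !mxE !eqxx expr1n big1 ?addr0//.
  by move=> k kj; rewrite !mxE (negbTE kj) expr0n.
apply: le_trans (_ : norm2 (A *m e) <= _).
  rewrite -ler_sqr ?nnegrE// norm2_sqr real_normK ?num_real//.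
  have -> : A i j = (A *m e) i 0 by rewrite -colE mxE.
  exact: sqr_le_sqn.
by apply: ub_le_sup => //; exists e.
Qed.

End RandomVectors.

(** * Moment estimates and mean-square convergence of the process *)

Section Process.
Context {d : measure_display} {T : measurableType d} {R : realType}.
Variable Pr : probability T R.
Variables (n : nat) (a : nat -> R) (Ps : nat -> T -> 'M[R]_n)
  (us x : nat -> T -> 'cV[R]_n) (P : 'M[R]_n) (x0 : 'cV[R]_n).
Hypothesis x_system : linear_system a Ps us x0 x.
Hypothesis hA1 : A1 Pr x Ps us P 0.
Local Notation L1 := (L1 Pr).
Local Notation L2 := (L2 Pr).
Local Notation E := (E Pr).
Local Notation Q := (P - 1%:M).

Let drift s w := Ps s w *m x s w + us s w - x s w.

Lemma x_step s w : x s.+1 w = x s w + a s *: drift s w.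
Proof.
by rewrite x_system.2 /drift scalerBl scale1r scalerBr !scalerDr addrAC -addrA.
Qed.

Lemma measurable_Ps s i j : measurable_fun [set: T] (fun w => Ps s w i j).
Proof. by case: hA1 => h _ _ _; case: (h s i j) => /measurable_int /measurable_EFinP. Qed.

Lemma measurable_us s i : measurable_fun [set: T] (fun w => us s w i 0).
Proof. by case: hA1 => _ h _ _; case: (h s i) => /measurable_int /measurable_EFinP. Qed.

Lemma measurable_x s i : measurable_fun [set: T] (fun w => x s w i 0).
Proof.
elim: s i => [|s ih] i.
  by under eq_fun do rewrite x_system.1; exact: measurable_cst.
under eq_fun do rewrite x_system.2 !mxE.
apply: measurable_funD; first exact: measurable_funM.
apply: measurable_funM => //; apply: measurable_funD; last exact: measurable_us.
apply: measurable_sum => j; apply: measurable_funM => //; exact: measurable_Ps.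
Qed.

Let U s := \big[setU/set0]_(i < n)
  preimage_set_system [set: T] (fun w => x s w i 0) measurable.
Let H s := \bigcup_(r in [set r | (r <= s)%N]) sigma_state x r.

Lemma sigma_state_measurable s : <<s U s >> `<=` measurable.
Proof.
apply: smallest_sub; first exact: sigma_algebra_measurable.
rewrite /U => A; rewrite -bigcup_seq => -[i _] [B mB <-].
exact: measurable_x.
Qed.

Lemma sigma_history_measurable s : <<s H s >> `<=` measurable.
Proof.
apply: smallest_sub; first exact: sigma_algebra_measurable.
by move=> A [r _] /sigma_state_measurable.
Qed.

Lemma sigma_state_x s i B : measurable B -> <<s U s >> ((fun w => x s w i 0) @^-1` B).
Proof.
move=> mB; apply: sub_sigma_algebra; rewrite /U -bigcup_seq.
by exists i; rewrite /= ?mem_index_enum//; exists B => //; rewrite setTI.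
Qed.

Lemma x_state_measurable s i :
  measurable_fun [set: g_sigma_algebraType (U s)] (fun w => x s w i 0).
Proof. by move=> _ B mB; rewrite setTI; exact: sigma_state_x. Qed.

Lemma x_history_measurable s r i : (r <= s)%N ->
  measurable_fun [set: g_sigma_algebraType (H s)] (fun w => x r w i 0).
Proof.
move=> rs _ B mB; rewrite setTI; apply: sub_sigma_algebra.
by exists r => //; exact: sigma_state_x.
Qed.

(** The squared entry is at most the squared norm, whose conditional mean given the state is
    bounded, while [x s w k 0 ^+ 2] is a function of the state. *)
Lemma Ps_sqr_bound : exists2 C, 0 <= C & forall s i j k, L2 (fun w => x s w k 0) ->
  L2 (fun w => Ps s w i j * x s w k 0) /\
  E (fun w => (Ps s w i j * x s w k 0) ^+ 2) <= C * E (fun w => x s w k 0 ^+ 2).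
Proof.
case: hA1 => _ _ [C hC] _; exists `|C| => // s i j k hx.
have [Z hZ ZC] := hC s.
have {}ZC : {ae Pr, forall w, Z w <= `|C|}.
  by apply: filterS ZC => w /le_trans; apply; exact: ler_norm.
have := cond_exp_mul_le (@sigma_state_measurable s) hZ ZC (normr_ge0 C)
  (fun w => sqr_ge0 _) (measurable_funX 2 (@x_state_measurable s k))
  (fun w => sqr_ge0 _) hx.2.
case=> i1 e1.
have mPx : measurable_fun [set: T] (fun w => Ps s w i j * x s w k 0).
  by apply: measurable_funM; [exact: measurable_Ps|exact: measurable_x].
have le w : (Ps s w i j * x s w k 0) ^+ 2 <= mxnorm2 (Ps s w) ^+ 2 * x s w k 0 ^+ 2.
  rewrite exprMn ler_wpM2r ?sqr_ge0// -[leLHS]real_normK ?num_real//.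
  by rewrite ler_sqr ?nnegrE ?(le_trans _ (mxnorm2_ge _ i j))// mxnorm2_ge.
have i2 : L1 (fun w => (Ps s w i j * x s w k 0) ^+ 2).
  apply: (L1_le _ i1) => [|w]; first exact: measurable_funX.
  by rewrite ger0_norm ?sqr_ge0.
split; first by split.
by apply: le_trans (E_le i2 i1 le) e1.
Qed.

Lemma us_sqr_bound : exists2 C, 0 <= C & forall s i,
  L2 (fun w => us s w i 0) /\ E (fun w => us s w i 0 ^+ 2) <= C.
Proof.
case: hA1 => _ _ _ [C hC]; exists `|C| => // s i.
have [Z hZ ZC] := hC s.
have {}ZC : {ae Pr, forall w, Z w <= `|C|}.
  by apply: filterS ZC => w /le_trans; apply; exact: ler_norm.
(* Against the constant factor 1, the conditional bound becomes a bound on the expectation. *)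
have m1 : measurable_fun [set: g_sigma_algebraType (U s)] (cst (1 : R)) by [].
have := cond_exp_mul_le (@sigma_state_measurable s) hZ ZC (normr_ge0 C)
  (fun w => sqr_ge0 _) m1 (fun w => ler01) (L1_cst Pr 1).
case=> i1 e1.
have le w : us s w i 0 ^+ 2 <= norm2 (us s w) ^+ 2 * cst 1 w.
  by rewrite mulr1 norm2_sqr sqr_le_sqn.
have i2 : L1 (fun w => us s w i 0 ^+ 2).
  apply: (L1_le _ i1) => [|w]; first by apply: measurable_funX; exact: measurable_us.
  by rewrite ger0_norm ?sqr_ge0.
split; first by split => //; exact: measurable_us.
by apply: le_trans (E_le i2 i1 le) _; rewrite (le_trans e1)// E_cst mulr1.
Qed.

Lemma vecL2_Psx s : vecL2 Pr (x s) -> vecL2 Pr (fun w => Ps s w *m x s w).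
Proof.
have [C C0 hC] := Ps_sqr_bound => hx i.
under [X in L2 X]eq_fun do rewrite mxE.
by apply: L2_sum => j; have [] := hC s i j j (hx j).
Qed.

Lemma vecL2_us s : vecL2 Pr (us s).
Proof. by have [C C0 hC] := us_sqr_bound => i; have [] := hC s i. Qed.

Lemma vecL2_drift_of s : vecL2 Pr (x s) -> vecL2 Pr (drift s).
Proof.
move=> hx; have := vecL2D (vecL2D (vecL2_Psx hx) (@vecL2_us s)) (vecL2Z (-1) hx).
by under [X in vecL2 _ X]eq_fun do rewrite scaleN1r.
Qed.

Lemma vecL2_x s : vecL2 Pr (x s).
Proof.
elim: s => [|s ih].
  by move=> i; under [X in L2 X]eq_fun do rewrite x_system.1; exact: L2_cst.
under [X in vecL2 _ X]eq_fun do rewrite x_step.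
by apply: vecL2D => //; apply: vecL2Z; exact: vecL2_drift_of.
Qed.

Lemma vecL2_drift s : vecL2 Pr (drift s).
Proof. exact/vecL2_drift_of/vecL2_x. Qed.

Lemma drift_bound : exists2 C, 0 <= C & forall s,
  E (fun w => sqn (drift s w)) <= C * (1 + E (fun w => sqn (x s w))).
Proof.
have [C1 C10 h1] := Ps_sqr_bound; have [C2 C20 h2] := us_sqr_bound.
have hx := vecL2_x.
have hPx s : E (fun w => sqn (Ps s w *m x s w)) <=
    n%:R * (n%:R * C1) * E (fun w => sqn (x s w)).
  have iPx i j : L1 (fun w => (Ps s w i j * x s w j 0) ^+ 2).
    by have [[]] := h1 s i j j (hx s j).
  apply: (@le_trans _ _ (E (fun w => \sum_i n%:R * \sum_j (Ps s w i j * x s w j 0) ^+ 2))).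
    apply: E_le.
    - by apply: L1_sqn; apply: vecL2_Psx.
    - by apply: L1_sum => i; apply: L1Z; apply: L1_sum.
    - move=> w; rewrite sqnE; apply: ler_sum => i _; rewrite mxE; exact: sqr_sum_le.
  rewrite E_sum; last by move=> i; apply: L1Z; apply: L1_sum.
  rewrite [leRHS](_ : _ =
      \sum_(i < n) n%:R * C1 * E (fun w => sqn (x s w))); last first.
    by rewrite sumr_const card_ord -[RHS]mulr_natl !mulrA.
  apply: ler_sum => i _; rewrite EZ; last exact: L1_sum.
  rewrite -mulrA ler_wpM2l// E_sum//.
  rewrite (eq_E _ (fun w => sqnE (x s w))) E_sum; last by move=> j; exact: (hx s j).2.
  rewrite mulr_sumr; apply: ler_sum => j _.
  by have [] := h1 s i j j (hx s j).
have hu s : E (fun w => sqn (us s w)) <= n%:R * C2.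
  rewrite (eq_E _ (fun w => sqnE (us s w))) E_sum; last by move=> i; exact: (h2 s i).1.2.
  apply: (@le_trans _ _ (\sum_(i < n) C2)); last by rewrite sumr_const card_ord mulr_natl.
  by apply: ler_sum => i _; exact: (h2 s i).2.
(* The factors 4, 4 and 2 come from two uses of [sqnD_le] on the three terms of the drift. *)
exists (4 * (n%:R * (n%:R * C1)) + 4 * (n%:R * C2) + 2) => [|s].
  by rewrite !addr_ge0// !mulr_ge0.
have iPx := L1_sqn (vecL2_Psx (hx s)); have iu := L1_sqn (@vecL2_us s).
have ix := L1_sqn (hx s).
apply: (@le_trans _ _ (E (fun w => (4 * sqn (Ps s w *m x s w) + 4 * sqn (us s w)) +
    2 * sqn (x s w)))).
  apply: E_le; first exact/L1_sqn/vecL2_drift.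
    by apply: L1D; [apply: L1D|]; exact: L1Z.
  move=> w; rewrite /drift.
  have := sqnD_le (Ps s w *m x s w + us s w) (- x s w).
  have := sqnD_le (Ps s w *m x s w) (us s w).
  have -> : sqn (- x s w) = sqn (x s w).
    by rewrite -scaleN1r /sqn dotZl dotZr !mulN1r opprK.
  by lra.
rewrite !ED ?EZ//; do ?[by apply: L1Z|by apply: L1D; apply: L1Z].
have := hPx s; have := hu s; have := E_sqn_ge0 Pr (x s).
move: (E _) (E _) (E _) => e1 e2 e3 e10.
have k1 : 0 <= n%:R * (n%:R * C1) by rewrite !mulr_ge0.
have k2 : 0 <= n%:R * C2 by rewrite mulr_ge0.
move: (n%:R * (n%:R * C1)) (n%:R * C2) k1 k2 => c1 c2 k1 k2 u1 u2.
by have := mulr_ge0 k2 e10; lra.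
Qed.

(** Against any history-measurable factor the drift acts as its conditional mean [Q *m x s]: the
    entries of [Ps] are replaced by those of [P], and [us] by 0. *)
Lemma E_mul_drift s (Y : T -> R) i :
  measurable_fun [set: g_sigma_algebraType (H s)] Y -> L2 Y ->
  E (fun w => Y w * drift s w i 0) = E (fun w => Y w * (Q *m x s w) i 0).
Proof.
move=> mY hY.
have hx := vecL2_x; have [C C0 hC] := Ps_sqr_bound.
case: hA1 => hP hu _ _.
have iPx j : L2 (fun w => Ps s w i j * x s w j 0) by have [] := hC s i j j (hx s j).
have eP j : E (fun w => Y w * (Ps s w i j * x s w j 0)) =
    P i j * E (fun w => Y w * x s w j 0).
  have <- := cond_exp_pull_out (@sigma_history_measurable s) (hP s i j)
    (measurable_funM mY (@x_history_measurable s s j (leqnn s))) (L2_mul hY (hx s j)) _.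
    by apply: eq_E => w /=; rewrite mulrCA.
  have := L2_mul hY (iPx j).
  by under [X in L1 X -> _]eq_fun do rewrite mulrCA.
have eu : E (fun w => Y w * us s w i 0) = 0.
  have := cond_exp_pull_out (@sigma_history_measurable s) (hu s i) mY (L2_L1 hY) _.
  rewrite mxE mul0r => <-; first by apply: eq_E => w; rewrite mulrC.
  have := L2_mul hY (@vecL2_us s i).
  by under [X in L1 X -> _]eq_fun do rewrite mulrC.
have ix j := L2_mul hY (hx s j).
transitivity (\sum_j P i j * E (fun w => Y w * x s w j 0) - E (fun w => Y w * x s w i 0)).
  rewrite (eq_E _ (g := fun w => \sum_j Y w * (Ps s w i j * x s w j 0) +
      (Y w * us s w i 0 + -1 * (Y w * x s w i 0)))); last first.
    by move=> w; rewrite /drift !mxE -mulr_sumr; ring.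
  rewrite ED ?ED ?E_sum ?EZ ?eu//.
  - by rewrite add0r mulN1r; congr (_ - _); apply: eq_bigr => j _; exact: eP.
  - by move=> j; exact: L2_mul.
  - exact: L2_mul hY (@vecL2_us s i).
  - exact: L1Z.
  - by apply: L1_sum => j; exact: L2_mul.
  - by apply: L1D; [exact: L2_mul hY (@vecL2_us s i)|exact: L1Z].
rewrite [RHS](eq_E _ (g := fun w => \sum_j P i j * (Y w * x s w j 0) +
    -1 * (Y w * x s w i 0))); last first.
  move=> w; rewrite mulmxBl mul1mx !mxE mulrBr mulr_sumr mulN1r; congr (_ - _).
  by apply: eq_bigr => j _; rewrite mulrCA.
rewrite ED ?E_sum ?EZ//.
- by rewrite mulN1r; congr (_ - _); apply: eq_bigr => j _; rewrite EZ.
- by move=> j; exact: L1Z.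
- by apply: L1_sum => j; exact: L1Z.
- exact: L1Z.
Qed.

(** Induction on [s], using [E_mul_drift] with the constant factor 1. *)
Lemma E_x s i : E (fun w => x s w i 0) = (mean_flow a P s *m x0) i 0.
Proof.
elim: s i => [|s ih] i.
  rewrite /= mul1mx (eq_E _ (g := cst (x0 i 0))) ?E_cst// => w.
  by rewrite x_system.1.
have m1 : measurable_fun [set: g_sigma_algebraType (H s)] (cst (1 : R)) by [].
have h1 := E_mul_drift i m1 (L2_cst Pr 1).
rewrite (eq_E _ (g := fun w => x s w i 0 + a s * (cst 1 w * drift s w i 0))); last first.
  by move=> w; rewrite x_step mxE mul1r mxE.
have ix := vecL2_x; have id := L2_mul (L2_cst Pr 1) (@vecL2_drift s i).
rewrite (ED (L2_L1 (ix s i)) (L1Z (a s) id)) (EZ _ id) h1.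
rewrite ih /= (mulmxDl (mean_flow a P s)) -scalemxAl -mulmxA [RHS]mxE [X in _ = _ + X]mxE; congr (_ + _ * _).
rewrite (eq_E _ (g := fun w => \sum_j Q i j * x s w j 0)); last first.
  by move=> w; rewrite mul1r mxE.
rewrite E_sum; last by move=> j; exact: (L1Z _ (L2_L1 (ix s j))).
rewrite [RHS]mxE; apply: eq_bigr => j _.
by rewrite (EZ _ (L2_L1 (ix s j))) ih.
Qed.

(** [V] is [x s] in the Lyapunov estimates and an increment [x s - x r] in the martingale
    estimate. *)
Lemma E_sqn_step m (A : 'M[R]_(m, n)) s (V : T -> 'cV[R]_n) :
  (forall k, measurable_fun [set: g_sigma_algebraType (H s)] (fun w => V w k 0)) ->
  vecL2 Pr V ->
  E (fun w => sqn (A *m V w + a s *: (A *m drift s w))) =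
  E (fun w => sqn (A *m V w)) +
  2 * a s * E (fun w => dot (A *m V w) (A *m (Q *m x s w))) +
  a s ^+ 2 * E (fun w => sqn (A *m drift s w)).
Proof.
move=> mV hV; have hd := @vecL2_drift s.
rewrite E_sqn_add; [|exact: vecL2_mulmx|exact: vecL2_mulmx].
rewrite (E_dot_mulmx A A hV hd (vecL2_mulmx Q (@vecL2_x s)))// => k i.
exact: E_mul_drift.
Qed.

Lemma ms_consensus_of_certificate : A2 a -> consensus_certificate P -> ms_consensus Pr x.
Proof.
move=> hA2 [m [L [p [N [c [c0 hL pQ hN]]]]]].
have [a0 _ ca] := hA2.
have hx := vecL2_x.
pose S := series (fun s => a s ^+ 2).
have [Cd Cd0 hd] := drift_bound.
have [KL KL0 hKL] := E_sqn_mulmx_le Pr L.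
have [Kp Kp0 hKp] := E_sqn_mulmx_le Pr p.
have [KN KN0 hKN] := E_sqn_mulmx_le Pr N.
pose vL s := E (fun w => sqn (L *m x s w)).
pose vp s := E (fun w => sqn (p *m x s w)).
pose vx s := E (fun w => sqn (x s w)).
have vL0 s : 0 <= vL s := E_sqn_ge0 _ _.
have vp0 s : 0 <= vp s := E_sqn_ge0 _ _.
have vx0 s : 0 <= vx s := E_sqn_ge0 _ _.
have iL s : L1 (fun w => sqn (L *m x s w)) by apply: L1_sqn; exact: vecL2_mulmx.
have stepE k (A : 'M[R]_(k, n)) s w :
    A *m x s.+1 w = A *m x s w + a s *: (A *m drift s w).
  by rewrite x_step mulmxDr -scalemxAr.
have stepL s : vL s.+1 <= vL s - 2 * c * a s * vL s + a s ^+ 2 * (KL * (Cd * (1 + vx s))).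
  rewrite /vL (eq_E _ (fun w => congr1 (@sqn R m) (stepE _ L s w))).
  rewrite E_sqn_step//; last by move=> k; exact: x_history_measurable.
  apply: lerD.
    rewrite lerD2l.
    have h : E (fun w => dot (L *m x s w) (L *m (Q *m x s w))) <= - c * vL s.
      rewrite -EZ//; apply: E_le => //; last exact: L1Z.
      by apply: L1_dot; do ?apply: vecL2_mulmx.
    have := ler_wpM2l (mulr_ge0 (ler0n R 2) (a0 s)) h; rewrite /vL; lra.
  rewrite ler_wpM2l ?sqr_ge0//; apply: le_trans (hKL _ (@vecL2_drift s)) _.
  by rewrite ler_wpM2l.
have dotp0 (v w : 'cV[R]_n) : dot (p *m v) (p *m (Q *m w)) = 0.
  by rewrite mulmxA pQ mul0mx /dot big1// => i _; rewrite [X in _ * X]mxE mulr0.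
have stepp s : vp s.+1 <= vp s + a s ^+ 2 * (Kp * (Cd * (1 + vx s))).
  rewrite /vp (eq_E _ (fun w => congr1 (@sqn R 1) (stepE _ p s w))).
  rewrite E_sqn_step//; last by move=> k; exact: x_history_measurable.
  rewrite (eq_E _ (fun w => dotp0 (x s w) (x s w))) (E_cst _ 0) mulr0 addr0 lerD2l.
  rewrite ler_wpM2l ?sqr_ge0//; apply: le_trans (hKp _ (@vecL2_drift s)) _.
  by rewrite ler_wpM2l.
pose o : 'cV[R]_n := const_mx 1.
have hxN s : E (fun w => sqn (x s w - o *m (p *m x s w))) <= KN * vL s.
  rewrite (eq_E _ (fun w => congr1 (@sqn R n) (hN (x s w)))).
  by apply: hKN; exact: vecL2_mulmx.
have [Ko Ko0 hKo] := E_sqn_mulmx_le Pr o.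
(* Splits [x] into its consensus part [o *m (p *m x)] and the remainder, which [L *m x] controls. *)
have vxb s : vx s <= (2 * KN + 2 * Ko) * (vL s + vp s).
  have i1 : L1 (fun w => sqn (x s w - o *m (p *m x s w))).
    apply: L1_sqn; rewrite (_ : (fun w => _) = (fun w => N *m (L *m x s w))).
      by do 2!apply: vecL2_mulmx.
    by apply/funext => w; exact: hN.
  have i2 : L1 (fun w => sqn (o *m (p *m x s w))).
    by apply: L1_sqn; do 2!apply: vecL2_mulmx.
  apply: (@le_trans _ _ (2 * (KN * vL s) + 2 * (Ko * vp s))); last first.
    have := mulr_ge0 KN0 (vp0 s); have := mulr_ge0 Ko0 (vL0 s); lra.
  apply: (@le_trans _ _ (E (fun w => 2 * sqn (x s w - o *m (p *m x s w)) +
      2 * sqn (o *m (p *m x s w))))).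
    apply: E_le; first exact: L1_sqn.
      by apply: L1D; exact: L1Z.
    by move=> w; have := sqnD_le (x s w - o *m (p *m x s w)) (o *m (p *m x s w)); rewrite subrK.
  rewrite ED ?EZ//; do ?exact: L1Z.
  apply: lerD; rewrite ler_wpM2l//.
  by apply: hKo; exact: vecL2_mulmx.
have [B hB] : exists B, forall s, vL s + vp s <= B.
  (* The dissipation in [stepL] is dropped here; the constant combines both drift bounds with
     [vxb]. *)
  apply: (@recursion_bounded _ a _ ((KL + Kp) * Cd * (1 + (2 * KN + 2 * Ko)))) => //.
  - by rewrite !mulr_ge0 ?addr_ge0 ?mulr_ge0.
  - by move=> s; rewrite addr_ge0.
  move=> s; have := stepL s; have := stepp s.
  have h1 : 0 <= 2 * c * a s * vL s by rewrite !mulr_ge0// ltW.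
  set K := 2 * KN + 2 * Ko in vxb *.
  have K0 : 0 <= K by rewrite addr_ge0 ?mulr_ge0.
  have h2 : 1 + vx s <= (1 + K) * (1 + (vL s + vp s)).
    have := vxb s; have := vL0 s; have := vp0 s; lra.
  have h3 := ler_wpM2l (mulr_ge0 (sqr_ge0 (a s)) (mulr_ge0 (addr_ge0 KL0 Kp0) Cd0)) h2.
  by lra.
have B0 : 0 <= B by apply: le_trans (hB 0%N); rewrite addr_ge0.
set K := 2 * KN + 2 * Ko in vxb.
have K0 : 0 <= K by rewrite addr_ge0 ?mulr_ge0.
have vxB s : vx s <= K * B by apply: le_trans (vxb s) _; rewrite ler_wpM2l.
have vL_cvg : vL @ \oo --> 0.
  apply: (@recursion_cvg0 _ a vL (2 * c) (KL * (Cd * (1 + K * B)))) => //.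
  - by rewrite mulr_gt0.
  - by rewrite !mulr_ge0// addr_ge0// mulr_ge0.
  move=> s; apply: le_trans (stepL s) _; rewrite lerD2l mulrC ler_wpM2r ?sqr_ge0//.
  by rewrite !ler_wpM2l// lerD2l.
pose M s w := (p *m x s w) 0 0.
have M2 s : L2 (M s) by exact: vecL2_mulmx.
pose Kb := Kp * (Cd * (1 + K * B)).
have Kb0 : 0 <= Kb by rewrite !mulr_ge0// addr_ge0// mulr_ge0.
(* Orthogonality of martingale increments: the cross terms vanish by [dotp0], and step [s] adds at
   most [Kb * a s ^+ 2]. *)
have hM r t : (r <= t)%N -> E (fun w => (M t w - M r w) ^+ 2) <= Kb * (S t - S r).
  have sq1 (v : 'cV[R]_1) : sqn v = v 0 0 ^+ 2 by rewrite sqnE big_ord1.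
  have ME s : E (fun w => (M s w - M r w) ^+ 2) = E (fun w => sqn (p *m (x s w - x r w))).
    by apply: eq_E => w; rewrite sq1 mulmxBr /M [in RHS]mxE [X in _ = (_ + X) ^+ 2]mxE.
  move=> /subnK <-; elim: (t - r)%N => [|k ih].
    rewrite add0n subrr mulr0 (eq_E _ (g := cst 0)) ?E_cst// => w.
    by rewrite subrr expr0n.
  rewrite addSn ME; set s := (k + r)%N in ih *.
  have rs : (r <= s)%N by rewrite leq_addl.
  have mV i : measurable_fun [set: g_sigma_algebraType (H s)]
      (fun w => (x s w - x r w) i 0).
    under eq_fun do rewrite mxE [X in _ + X]mxE.
    by apply: measurable_funB; exact: x_history_measurable.
  have hV : vecL2 Pr (fun w => x s w - x r w).
    have := vecL2D (hx s) (vecL2Z (-1) (hx r)).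
    by under [X in vecL2 _ X -> _]eq_fun do rewrite scaleN1r.
  rewrite (eq_E _ (g := fun w => sqn (p *m (x s w - x r w) + a s *: (p *m drift s w)))); last first.
    by move=> w; rewrite x_step addrAC (mulmxDr p) -scalemxAr.
  rewrite E_sqn_step// (eq_E _ (fun w => dotp0 (x s w - x r w) (x s w))) (E_cst _ 0).
  rewrite mulr0 addr0 -ME.
  have -> : S s.+1 = S s + a s ^+ 2 by rewrite /S seriesSr.
  have h1 : E (fun w => sqn (p *m drift s w)) <= Kb.
    apply: le_trans (hKp _ (@vecL2_drift s)) _; rewrite ler_wpM2l//.
    by apply: le_trans (hd s) _; rewrite ler_wpM2l// lerD2l; exact: vxB.
  by have := ler_wpM2l (sqr_ge0 (a s)) h1; lra.
have [Minf Minf2 Mcvg] : exists2 Minf, L2 Minf &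
    E (fun w => (M s w - Minf w) ^+ 2) @[s --> \oo] --> 0.
  apply: (@L2_complete _ _ _ _ M (fun s => Kb * (limn S - S s))) => //.
    move=> s t st; apply: le_trans (hM s t st) _; rewrite ler_wpM2l// lerD2r.
    exact: series_sqr_le_lim.
  rewrite -[X in _ --> X](mulr0 Kb) -(subrr (limn S)).
  by apply: cvgMl_tmp; apply: cvgB => //; exact: cvg_cst.
have oE s w : o *m (p *m x s w) = const_mx (M s w).
  by apply/matrixP => i j; rewrite mxE big_ord1 !ord1 [X in X * _]mxE [RHS]mxE mul1r.
pose y s w := x s w - o *m (p *m x s w).
have hy s : vecL2 Pr (y s).
  rewrite (_ : y s = (fun w => N *m (L *m x s w))); first by do 2!apply: vecL2_mulmx.
  by apply/funext => w; exact: hN.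
have y_cvg : E (fun w => sqn (y s w)) @[s --> \oo] --> 0.
  apply: (squeeze_cvgr (f := cst 0) (h := fun s => KN * vL s)).
  - by apply: nearW => s; rewrite hxN E_sqn_ge0.
  - exact: cvg_cst.
  - by rewrite -[X in _ --> X](mulr0 KN); apply: cvgMl_tmp.
pose xlim w : 'cV[R]_n := const_mx (Minf w).
have hxlim : vecL2 Pr xlim by move=> i; under [X in L2 X]eq_fun do rewrite mxE.
have hMd s : L2 (fun w => M s w - Minf w).
  have := L2D (M2 s) (L2Z (-1) Minf2).
  by under [X in L2 X -> _]eq_fun do rewrite mulN1r.
split.
  exists xlim; split.
  - by move=> i; exact: (hxlim i).1.
  - rewrite unlock (_ : (fun w => _) = (fun w => (sqn (xlim w))%:E)).
      by rewrite EFin_E ?ltry//; exact: L1_sqn.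
    by apply/funext => w; rewrite norm2_sqr.
  have hd2 s : vecL2 Pr (fun w => x s w - xlim w).
    have := vecL2D (hx s) (vecL2Z (-1) hxlim).
    by under [X in vecL2 _ X -> _]eq_fun do rewrite scaleN1r.
  rewrite (_ : (fun s => _) = (fun s => (E (fun w => sqn (x s w - xlim w)))%:E)); last first.
    apply/funext => s; rewrite unlock -EFin_E; last exact: L1_sqn.
    by apply: eq_integral => w _; rewrite norm2_sqr.
  apply: cvg_EFin; first exact: nearW.
  apply: (squeeze_cvgr (f := cst 0) (h := fun s => 2 * E (fun w => sqn (y s w)) +
      2 * n%:R * E (fun w => (M s w - Minf w) ^+ 2))).
  - apply: nearW => s /=; rewrite E_sqn_ge0/=.
    rewrite -!EZ; [|exact: (hMd s).2|exact: L1_sqn].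
    rewrite -ED; [|exact/L1Z/L1_sqn|exact: L1Z _ (hMd s).2].
    apply: E_le; first exact: L1_sqn.
      by apply: L1D; [exact/L1Z/L1_sqn|exact: L1Z _ (hMd s).2].
    move=> w; have -> : x s w - xlim w = y s w + const_mx (M s w - Minf w).
      rewrite /y oE; apply/matrixP => i j; rewrite !mxE; move: (M s w) => q.
      by rewrite addrA addrNK.
    apply: le_trans (sqnD_le _ _) _; rewrite lerD2l -mulrA ler_wpM2l//.
    rewrite sqnE; under eq_bigr do rewrite mxE.
    by rewrite sumr_const card_ord mulr_natl.
  - exact: cvg_cst.
  - rewrite -[X in _ --> X](_ : 2 * 0 + 2 * n%:R * 0 = 0 :> R); last by rewrite !mulr0 addr0.
    by apply: cvgD; apply: cvgMl_tmp.
move=> i j.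
have hij s : L2 (fun w => x s w i 0 - x s w j 0).
  have := L2D (hx s i) (L2Z (-1) (hx s j)).
  by under [X in L2 X -> _]eq_fun do rewrite mulN1r.
rewrite (_ : (fun s => _) = (fun s => (E (fun w => `|x s w i 0 - x s w j 0|))%:E)); last first.
  by apply/funext => s; rewrite unlock -EFin_E//; exact/L1_norm/L2_L1.
apply: cvg_EFin; first exact: nearW.
(* The consensus part cancels in [x_i - x_j], and [(y_i - y_j)^2 <= 2 y_i^2 + 2 y_j^2 <= 4
   |y|^2]. *)
apply: (squeeze_cvgr (f := cst 0) (h := fun s => Num.sqrt (4 * E (fun w => sqn (y s w))))).
- apply: nearW => s /=; rewrite E_ge0//=.
  rewrite -[leLHS]ger0_norm ?E_ge0// -sqrtr_sqr ler_wsqrtr//.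
  apply: le_trans (sqr_E_norm_le (hij s)) _; rewrite -EZ; last exact: L1_sqn.
  apply: E_le; [exact: (hij s).2|exact/L1Z/L1_sqn|] => w.
  have -> : x s w i 0 - x s w j 0 = y s w i 0 - y s w j 0.
    by rewrite /y oE !mxE; move: (M s w) => q; rewrite opprB addrA addrNK.
  have := sqr_le_sqn (y s w) i; have := sqr_le_sqn (y s w) j.
  by have := sqr_ge0 (y s w i 0 + y s w j 0); rewrite !expr2; lra.
- exact: cvg_cst.
- have h4 : 4 * E (fun w => sqn (y s w)) @[s --> \oo] --> 0.
    by rewrite -[X in _ --> X](mulr0 4); exact: cvgMl_tmp.
  rewrite -[X in _ --> X](sqrtr0 R).
  exact: (cvg_comp _ _ h4 (@sqrt_continuous R 0)).
Qed.

(** Taking expectations turns mean-square consensus into a statement on the deterministic flow,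
    through [E_x]. *)
Lemma mean_consensus_of_ms : ms_consensus Pr x ->
  (forall i, exists B, \forall s \near \oo, (mean_flow a P s *m x0) i 0 <= B) /\
  (forall i j,
    (mean_flow a P s *m x0) i 0 - (mean_flow a P s *m x0) j 0 @[s --> \oo] --> 0).
Proof.
move=> [[xlim [mlim hlim hcv]] hcons].
have hx := vecL2_x.
have sqE (V : T -> 'cV[R]_n) : (fun w => norm2 (V w) ^+ 2) = (fun w => sqn (V w)).
  by apply/funext => w; rewrite norm2_sqr.
have lim2 : L1 (fun w => sqn (xlim w)).
  apply: L1_ge0 => [|w|].
  - rewrite (_ : (fun w => _) = (fun w => \sum_i xlim w i 0 ^+ 2)).
      by apply: measurable_sum => i; exact: measurable_funX.
    by apply/funext => w; rewrite sqnE.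
  - exact: sqn_ge0.
  - by move: hlim; rewrite sqE unlock.
have hxl : vecL2 Pr xlim.
  move=> i; split => //; apply: L1_le lim2 _; first exact: measurable_funX.
  by move=> w; rewrite ger0_norm ?sqr_ge0// sqr_le_sqn.
have hd s : vecL2 Pr (fun w => x s w - xlim w).
  have := vecL2D (hx s) (vecL2Z (-1) hxl).
  by under [X in vecL2 _ X -> _]eq_fun do rewrite scaleN1r.
have d_cvg : E (fun w => sqn (x s w - xlim w)) @[s --> \oo] --> 0.
  have /fine_cvg : (E (fun w => sqn (x s w - xlim w)))%:E @[s --> \oo] --> 0%:E.
    rewrite (_ : (fun s => _) = (fun s => 'E_Pr[fun w => (norm2 (x s w - xlim w) ^+ 2)%R]%E))//.
    by apply/funext => s; rewrite sqE unlock -EFin_E//; exact: L1_sqn.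
  by [].
split=> [i|i j].
  (* Each entry [t] of [x s - xlim] satisfies [t <= t^2 + 1], and the mean of its square is
     eventually below 1. *)
  exists (2 + E (fun w => xlim w i 0)); near=> s.
  rewrite -E_x (eq_E _ (g := fun w => (x s w - xlim w) i 0 + xlim w i 0)); last first.
    by move=> w; rewrite mxE [X in _ + X + _]mxE subrK.
  rewrite ED; [|exact: L2_L1 (hd s i)|exact: L2_L1].
  rewrite lerD2r; apply: (@le_trans _ _ (E (fun w => sqn (x s w - xlim w) + cst 1 w))).
    apply: E_le; [exact: L2_L1 (hd s i)|by apply: L1D; [exact: L1_sqn|exact: L1_cst]|].
    move=> w; have := sqr_le_sqn (x s w - xlim w) i.
    move: ((x s w - xlim w) i 0) (sqn _) => t q /=.
    by have := sqr_ge0 (t - 1); have := sqr_ge0 t; rewrite !expr2; lra.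
  rewrite ED; [|exact: L1_sqn|exact: L1_cst].
  rewrite E_cst -[leRHS]/(1 + 1) lerD2r ltW//; near: s.
  exact: cvgr_lt d_cvg _ ltr01.
have hij s : L2 (fun w => x s w i 0 - x s w j 0).
  have := L2D (hx s i) (L2Z (-1) (hx s j)).
  by under [X in L2 X -> _]eq_fun do rewrite mulN1r.
have a_cvg : E (fun w => `|x s w i 0 - x s w j 0|) @[s --> \oo] --> 0.
  have /fine_cvg : (E (fun w => `|x s w i 0 - x s w j 0|))%:E @[s --> \oo] --> 0%:E.
    rewrite (_ : (fun s => _) = (fun s => 'E_Pr[fun w => `|x s w i 0 - x s w j 0|%R]%E))//.
    by apply/funext => s; rewrite unlock -EFin_E//; exact/L1_norm/L2_L1.
  by [].
apply/norm_cvg0P; apply: (squeeze_cvgr (f := cst 0) _ _ a_cvg); last exact: cvg_cst.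
apply: nearW => s /=; rewrite normr_ge0/= -!E_x.
have -> : E (fun w => x s w i 0) - E (fun w => x s w j 0) =
    E (fun w => x s w i 0 - x s w j 0).
  rewrite [RHS](eq_E _ (g := fun w => x s w i 0 + -1 * x s w j 0)); last first.
    by move=> w; rewrite mulN1r.
  have i1 := L2_L1 (hx s i); have i2 := L2_L1 (hx s j).
  by rewrite ED ?EZ ?mulN1r//; exact: L1Z.
by apply: le_normr_Rintegral => //; exact: L2_L1.
Unshelve. all: by end_near. Qed.

End Process.

Local Close Scope classical_set_scope.

(* The coefficients P(s), u(s) may depend on the state, hence on the initial
   state x0; all trajectories live on the same probability space. *)
Theorem corollary4p1 (R : realType) (d : measure_display) (T : measurableType d)
    (Pr : probability T R) (n : nat) (n_gt0 : (0 < n)%N)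
    (a : nat -> R)
    (Ps : 'cV[R]_n -> nat -> T -> 'M[R]_n)
    (us : 'cV[R]_n -> nat -> T -> 'cV[R]_n)
    (x : 'cV[R]_n -> nat -> T -> 'cV[R]_n)
    (P : 'M[R]_n)
    (x_system : forall x0, linear_system a (Ps x0) (us x0) x0 (x x0))
    (hA1 : forall x0, A1 Pr (x x0) (Ps x0) (us x0) P 0)
    (hA2 : A2 a) :
  (forall x0, ms_consensus Pr (x x0)) <->
  (rho_max P < 1 \/
   ((forall i, \sum_(j < n) P i j = 1) /\
    count (fun z => complex.Re z < 1) (eigenvalues P) = n.-1)).
Proof.
case: n n_gt0 => [//|m] _ in Ps us x P x_system hA1 *; split=> [hms|hP x0].
  (* Initial states become the test vectors [u] of the deterministic lemma. *)
  have hmean x0 := mean_consensus_of_ms (x_system x0) (hA1 x0) (hms x0).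
  have [a0 ay _] := hA2.
  apply: (@spectrum_of_mean_consensus R a m P) => //.
    by move=> u i; exact: (hmean u).1.
  by move=> u i j; exact: (hmean u).2.
apply: (ms_consensus_of_certificate (x_system x0) (hA1 x0) hA2).
exact: (@certificate_of_spectrum R m P).
Qed.
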